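(* Let $p\in[1,\infty]$, $\frac1p+\frac1{p^*}=1$, let $\omega>0$ and $q\ge1$ an integer be fixed, and for each $s\in\mathbb{N}$ consider the finite diameter weights \[ \gamma_{\mathfrak{u}}=\begin{cases}\omega^{|\mathfrak{u}|}&\text{if }\mathrm{diam}(\mathfrak{u})\le q,\\0&\text{if }\mathrm{diam}(\mathfrak{u})>q,\end{cases}\qquad\mathfrak{u}\subseteq[s], \] where $\mathrm{diam}(\mathfrak{u})=\max_{i,j\in\mathfrak{u}}|i-j|$ and $\mathrm{diam}(\emptyset)=0$. Let $\imath:F_{s,p,\boldsymbol{\gamma}}\hookrightarrow H_{s,p,\boldsymbol{\gamma}}$, $\imath(f)=f$, be the embedding of the anchored space into the ANOVA space. Then, as $s\to\infty$, \[ \|\imath\|_{F_{s,p,\boldsymbol{\gamma}}\hookrightarrow H_{s,p,\boldsymbol{\gamma}}}=\Theta\left((s-q)^{1/p^*}\right), \] with implied constants independent of $s$.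
   Context: Notation: $[s]=\{1,\dots,s\}$, $D=[0,1]$, $D^{\mathfrak{u}}=D^{|\mathfrak{u}|}$ with coordinates indexed by $\mathfrak{u}\subseteq[s]$, $\mathfrak{u}^c=[s]\setminus\mathfrak{u}$, $\boldsymbol{x}_{\mathfrak{u}}=(x_j)_{j\in\mathfrak{u}}$; $[\boldsymbol{x}_{\mathfrak{u}};\boldsymbol{t}_{\mathfrak{u}^c}]$ has entries $x_j$ for $j\in\mathfrak{u}$ and $t_j$ for $j\notin\mathfrak{u}$. $f^{(\mathfrak{u})}=\prod_{j\in\mathfrak{u}}\frac{\partial}{\partial x_j}f$, $f^{(\emptyset)}=f$. $\boldsymbol{1}_I$ is the characteristic function of $I$. All functions are real-valued. $L_p(D^\emptyset)$ is identified with $\mathbb{R}$ with the absolute value as norm. $\mathfrak{U}=\{\mathfrak{u}\subseteq[s]:\gamma_{\mathfrak{u}}>0\}$. Anchored space: $F_{s,p,\boldsymbol{\gamma}}$ is the space of functions on $D^s$ of the form $f=\sum_{\mathfrak{u}\in\mathfrak{U}}f_{\mathfrak{u}}$ with $f_{\mathfrak{u}}(\boldsymbol{x})=\int_{D^{\mathfrak{u}}}h_{\mathfrak{u}}(\boldsymbol{t}_{\mathfrak{u}})\prod_{j\in\mathfrak{u}}\boldsymbol{1}_{[0,x_j)}(t_j)\,\mathrm{d}\boldsymbol{t}_{\mathfrak{u}}$, $h_{\mathfrak{u}}\in L_p(D^{\mathfrak{u}})$ ($f_\emptyset$ is a constant). This decomposition is unique, $h_{\mathfrak{u}}=f^{(\mathfrak{u})}([\cdot_{\mathfrak{u}};\boldsymbol{0}_{\mathfrak{u}^c}])$,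 and the norm is $\|f\|_{F_{s,p,\boldsymbol{\gamma}}}=\big(\sum_{\mathfrak{u}\in\mathfrak{U}}\gamma_{\mathfrak{u}}^{-p}\|h_{\mathfrak{u}}\|_{L_p(D^{\mathfrak{u}})}^p\big)^{1/p}$. ANOVA space: $H_{s,p,\boldsymbol{\gamma}}$ is the space of functions of the form $f=\sum_{\mathfrak{u}\in\mathfrak{U}}f_{\mathfrak{u}}$ with $f_{\mathfrak{u}}(\boldsymbol{x})=\int_{D^{\mathfrak{u}}}g_{\mathfrak{u}}(\boldsymbol{t}_{\mathfrak{u}})\prod_{j\in\mathfrak{u}}(\boldsymbol{1}_{[0,x_j)}(t_j)-(1-t_j))\,\mathrm{d}\boldsymbol{t}_{\mathfrak{u}}$, $g_{\mathfrak{u}}\in L_p(D^{\mathfrak{u}})$. This decomposition is unique, $g_{\mathfrak{u}}=\int_{D^{\mathfrak{u}^c}}f^{(\mathfrak{u})}([\cdot_{\mathfrak{u}};\boldsymbol{t}_{\mathfrak{u}^c}])\,\mathrm{d}\boldsymbol{t}_{\mathfrak{u}^c}$, and the norm is $\|f\|_{H_{s,p,\boldsymbol{\gamma}}}=\big(\sum_{\mathfrak{u}\in\mathfrak{U}}\gamma_{\mathfrak{u}}^{-p}\|g_{\mathfrak{u}}\|_{L_p(D^{\mathfrak{u}})}^p\big)^{1/p}$. For $p=\infty$ the sums in the two norms are read as $\max_{\mathfrak{u}\in\mathfrak{U}}\gamma_{\mathfrak{u}}^{-1}\|\cdot\|_{L_\infty}$. For these weights the two spaces are equal as sets of functions, so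 $\imath$ is well defined; $\|\imath\|$ is its operator norm. $1/p^*=0$ for $p=1$. $a_s=\Theta(b_s)$ means that there are constants $0<c_1\le c_2<\infty$ (which may depend on $p,q,\omega$ but not on $s$) with $c_1b_s\le a_s\le c_2b_s$ for all sufficiently large $s$. *)

(* Defs.v *)
From HB Require Import structures.
From mathcomp Require Import all_boot all_order all_algebra.
From mathcomp Require Import all_classical all_reals all_analysis.

Set Implicit Arguments.
Unset Strict Implicit.
Unset Printing Implicit Defensive.

Import Order.TTheory GRing.Theory Num.Theory.
Import numFieldNormedType.Exports.

Local Open Scope classical_set_scope.
Local Open Scope ring_scope.

(** R^n, with the product of the Borel sigma-algebras. *)
Notation vec R n := (n.-tuple (measurableTypeR R)).

Section cube_measure.
Context {R : realType}.

Definition cube {n} : set (vec R n) :=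
  [set x | forall i : 'I_n, 0 <= tnth x i <= 1].

Definition unit_measure : set (measurableTypeR R) -> \bar R :=
  mrestr (@lebesgue_measure R) (measurable_itv `[0, 1]).

HB.instance Definition _ := Measure.on unit_measure.

Let unit_measure_setT : unit_measure [set: measurableTypeR R] = 1%:E.
Proof.
by rewrite /unit_measure /mrestr setTI lebesgue_measure_itv/= lte_fin ltr01
  sube0.
Qed.

HB.instance Definition _ :=
  @Measure_isProbability.Build _ _ R unit_measure unit_measure_setT.

Definition vcons n (z : measurableTypeR R * vec R n) : vec R n.+1 :=
  [the n.+1.-tuple _ of z.1 :: z.2].

Let measurable_vcons n : measurable_fun setT (@vcons n).
Proof. exact: measurable_cons. Qed.

HB.instance Definition _ n :=
  isMeasurableFun.Build _ _ _ _ (@vcons n) (@measurable_vcons n).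

(** Lebesgue measure on [0, 1]^n, as a measure on R^n that vanishes outside the
    cube. For n = 0 it is the unit mass at the empty tuple, so that
    L_p([0, 1]^0) is R with the absolute value. *)
Fixpoint cube_measure n : probability (vec R n) R :=
  match n with
  | 0 => dirac ([tuple] : vec R 0)
  | m.+1 => distribution (unit_measure \x cube_measure m)%E (@vcons m)
  end.

End cube_measure.

Section weighted_spaces.
Context {R : realType} {s : nat}.
Implicit Types (u : {set 'I_s}) (x : vec R s) (f : vec R s -> R) (p : \bar R)
  (gamma : {set 'I_s} -> R) (k : R -> R -> R).

(** The coordinates in u, listed in increasing order, identify [0, 1]^u with
    [0, 1]^#|u|. *)
Definition subpoint x u : vec R #|u| :=
  [tuple tnth x (enum_val i) | i < #|u|].

(** The integral over [0, 1]^u of h(t) \prod_(j in u) k(x_j, t_j). *)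
Definition component k u (h : vec R #|u| -> R) x : R :=
  \int[cube_measure #|u|]_t
    (h t * \prod_(i < #|u|) k (tnth (subpoint x u) i) (tnth t i)).

(** A family (h_u)_u; only its members with gamma u > 0 are ever used. *)
Definition coef_family : Type := forall u, vec R #|u| -> R.

(** Functions on [0, 1]^s are functions on R^s considered on the cube only. *)
Definition decomposition k p gamma f (h : coef_family) : Prop :=
  (forall u, 0 < gamma u -> h u \in Lfun (cube_measure #|u|) p) /\
  (forall x, cube x ->
     f x = \sum_(u : {set 'I_s} | 0 < gamma u) component k (h u) x).

Definition family_norm p gamma (h : coef_family) : \bar R :=
  match p with
  | r%:E =>
      ((\sum_(u : {set 'I_s} | (0 < gamma u)%R)
          (gamma u `^ (- r))%R%:E
            * ('N[cube_measure #|u|]_(r%:E)[EFin \o h u]) `^ r) `^ r^-1)%E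
  | +oo%E =>
      (\big[maxe/0]_(u : {set 'I_s} | (0 < gamma u)%R)
          (((gamma u)^-1)%R%:E * 'N[cube_measure #|u|]_(+oo)[EFin \o h u]))%E
  | -oo%E => +oo%E (* only 1 <= p is meant *)
  end.

Definition space k p gamma : set (vec R s -> R) :=
  [set f | exists h, decomposition k p gamma f h].

(** The norm of f is read off from its decomposition, which is unique (up to
    null sets) for the two kernels below; it is +oo when f is not in the
    space. *)
Definition space_norm k p gamma f : \bar R :=
  match pselect (exists h, decomposition k p gamma f h) with
  | left e => family_norm p gamma (projT1 (cid e))
  | right _ => +oo%E
  end.

Definition anchored_kernel (x t : R) : R := \1_(`[0, x[) t.

Definition anova_kernel (x t : R) : R := \1_(`[0, x[) t - (1 - t).

Definition anchored_space := space anchored_kernel.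
Definition anchored_norm := space_norm anchored_kernel.
Definition anova_space := space anova_kernel.
Definition anova_norm := space_norm anova_kernel.

(** Operator norm of the embedding of the anchored space into the ANOVA space;
    it is +oo unless the former space is contained in the latter. *)
Definition embedding_norm p gamma : \bar R :=
  ereal_sup [set anova_norm p gamma f | f in
    [set f | anchored_space p gamma f /\ (anchored_norm p gamma f <= 1)%E]].

End weighted_spaces.

(** Coordinates are numbered from 0, which leaves the differences unchanged. *)
Definition diam s (u : {set 'I_s}) : nat :=
  (\max_(i in u) \max_(j in u) `|(i : nat)%:Z - (j : nat)%:Z|)%N.

Definition finite_diameter_weight (R : realType) (omega : R) (q s : nat)
    (u : {set 'I_s}) : R :=
  if (diam u <= q)%N then omega ^+ #|u| else 0.

(* Main.v *)
Require Import Defs.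
From HB Require Import structures.
From mathcomp Require Import all_boot all_order all_algebra.
From mathcomp Require Import all_classical all_reals all_analysis.
From mathcomp Require Import measurable_realfun ess_sup_inf lra ring zify.

(** Since 1_[0, x)(t) = (1_[0, x)(t) - (1 - t)) + (1 - t), expanding the product
    over u of the anchored kernels turns an anchored decomposition (h_u) of f
    into an ANOVA decomposition of f with
      g_v(t_v) = sum_(u >= v) int h_u(t_v, y) prod_(j in u - v) (1 - y_j) dy,
    and the same expansion with - (1 - t) goes back.  Each summand has L_p norm
    at most that of h_u.  All the weights are bounded above and below, every u
    has at most 2^(q+1) subsets, and at most s 2^(q+1) sets u carry a positive
    weight; so the l_1-l_p comparison on s 2^(q+1) terms bounds the norm of the
    embedding by a multiple of s^(1/p-star).  The function
    f(x) = omega s^(-1/p) (x_1 + ... + x_s), which has anchored norm 1 and mean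
    omega s^(1/p-star) / 2, shows that this order is attained.

    As the norms are read off from an arbitrary decomposition, both kinds of
    decompositions must be shown to be unique.  For the anchored one, put
    x_j = 0 for j outside u and induct on u; the boxes [0, x) then determine h_u.
    The ANOVA one reduces to it by the backward expansion, whose coefficients
    are triangular with respect to inclusion. *)

Set Implicit Arguments.
Unset Strict Implicit.
Unset Printing Implicit Defensive.

Import Order.TTheory GRing.Theory Num.Theory.
Import numFieldNormedType.Exports.

Local Open Scope classical_set_scope.
Local Open Scope ring_scope.

(** * Norms and marginals *)

Section Lnorm_lemmas.
Context d (T : measurableType d) (R : realType).
Implicit Types (f g w : T -> R) (p : \bar R).

Lemma measurable_powR_norm (r : R) f : measurable_fun setT f ->
  measurable_fun [set: T] (fun x => (`|f x| `^ r)%:E).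
Proof.
move=> mf; apply/measurable_EFinP.
apply: (@measurableT_comp _ _ _ _ _ _ (@powR R ^~ r)) => //.
exact: measurableT_comp.
Qed.

Lemma ae_le_Lnorm (mu : {measure set T -> \bar R}) p f g : (1 <= p)%E ->
  measurable_fun setT f -> measurable_fun setT g ->
  (\forall x \ae mu, `|f x| <= `|g x|) ->
  ('N[mu]_p[EFin \o f] <= 'N[mu]_p[EFin \o g])%E.
Proof.
case: p => [r||//] p1 mf mg fg; rewrite unlock /Lnorm.
- rewrite lee_fin in p1; have r0 : 0 < r by apply: lt_le_trans p1.
  apply: gt0_ler_poweR; rewrite ?in_itv ?invr_ge0 ?(ltW r0)//=.
  + by rewrite integral_ge0 ?leey// => x _; rewrite poweR_ge0.
  + by rewrite integral_ge0 ?leey// => x _; rewrite poweR_ge0.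
  + apply: ae_ge0_le_integral => //=.
    * exact: measurable_powR_norm.
    * exact: measurable_powR_norm.
    * apply: filterS fg => x fg _; rewrite lee_fin.
      by apply: ge0_ler_powR; rewrite ?nnegrE ?(ltW r0).
- case: ifPn => // _; apply: le_ess_sup.
  by apply: filterS fg => x; rewrite /= lee_fin.
Qed.

Lemma ae_eq_Lnorm (mu : {measure set T -> \bar R}) p f g : (1 <= p)%E ->
  measurable_fun setT f -> measurable_fun setT g ->
  (\forall x \ae mu, f x = g x) ->
  ('N[mu]_p[EFin \o f] = 'N[mu]_p[EFin \o g])%E.
Proof.
move=> p1 mf mg fg; apply/eqP; rewrite eq_le.
by rewrite !ae_le_Lnorm//; apply: filterS fg => x ->.
Qed.

Lemma Lfun_measurable (mu : {measure set T -> \bar R}) p f :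
  f \in Lfun mu p -> measurable_fun setT f.
Proof. by rewrite inE => /andP[]; rewrite inE. Qed.

Lemma Lfun_inP (mu : {measure set T -> \bar R}) p f :
  f \in Lfun mu p <->
  measurable_fun setT f /\ ('N[mu]_p[EFin \o f] < +oo)%E.
Proof.
split=> [|[mf Nf]]; first by rewrite inE => /andP[]; rewrite !inE.
by rewrite inE; apply/andP; rewrite !inE.
Qed.

Variable P : probability T R.

Lemma Lfun_prob_integrable p f : (1 <= p)%E -> f \in Lfun P p ->
  P.-integrable setT (EFin \o f).
Proof.
move=> p1 fp; apply/Lfun1_integrable.
by apply: (Lfun_subset _ p1 _ p1 fp) => //; exact: fin_num_measure.
Qed.

Let probT : (P : {measure set T -> \bar R}) [set: T] = 1%E.
Proof. exact: probability_setT. Qed.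

(** Hoelder's inequality against the constant 1, whose norm is 1 because [P] has total mass 1; for p
    infinite, integrate the essential supremum. *)
Lemma Lnorm1_le p f : (1 <= p)%E -> measurable_fun setT f ->
  (\int[P]_x `|(f x)%:E| <= 'N[P]_p[EFin \o f])%E.
Proof.
case: p => [r||//] p1 mf.
(* For r = 1 the conjugate exponent (1 - 1/r)^-1 degenerates to 0, so Hoelder is applied only for r
   > 1. *)
- have [->|r1] := eqVneq r 1; first by rewrite Lnorm1.
  rewrite lee_fin in p1; have {}r1 : 1 < r by rewrite lt_neqAle eq_sym r1.
  have r0 : 0 < r by apply: lt_trans r1.
  have := @hoelder _ _ _ P f (cst 1) r (1 - r^-1)^-1 mf (measurable_cst _) r0.
  rewrite Lnorm_cst1 probT poweR1r mule1 Lnorm1.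
  under eq_integral do rewrite /= mulr1.
  apply; last by rewrite invrK addrC subrK.
  by rewrite invr_gt0 subr_gt0 invf_lt1.
- rewrite unlock /Lnorm probT lte01.
  set M := ess_sup _ _.
  apply: (@le_trans _ _ (\int[P]_x M)%E); last first.
    by rewrite integral_cst//= ?probT ?mule1.
  apply: ae_ge0_le_integral => //.
  + by do 2 apply: measurableT_comp => //.
  + move=> x _; apply: ess_sup_gee; first by rewrite probT lte01.
    by apply: nearW => y /=.
  + by have := ess_sup_ge P (abse \o (EFin \o f)); apply: filterS.
Qed.

End Lnorm_lemmas.

(** * Iterated integrals over a product of two probability spaces *)

Section Lnorm_product.
Context d1 d2 (T1 : measurableType d1) (T2 : measurableType d2) (R : realType).
Variables (P1 : probability T1 R) (P2 : probability T2 R).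

(** The measures of the sections of a product null set integrate to 0, so almost every section is
    null. *)
Lemma ae_product (A : set (T1 * T2)) : measurable A ->
  (\forall z \ae (P1 \x P2)%E, A z) ->
  \forall x \ae P1, \forall y \ae P2, A (x, y).
Proof.
move=> mA [N [mN N0 AN]].
have : (\int[P1]_x `|P2 (xsection N x)| = 0)%E.
  rewrite -N0; apply: eq_integral => x _.
  by rewrite gee0_abs.
move/(ae_eq_integral_abs P1 measurableT (measurable_fun_xsection P2 mN)).
apply: filterS => x /(_ I) /= Nx.
exists (xsection N x); split => //; first exact: measurable_xsection.
by move=> y /= nA; rewrite /xsection /= inE; apply: AN.
Qed.

(** Without integrability of [F], Tonelli is applied to the positive and negative parts
    separately. *)
Lemma measurable_fun_Rintegral (F : T1 * T2 -> R) :
  measurable_fun [set: T1 * T2] F ->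
  measurable_fun [set: T1] (fun x => \int[P2]_y F (x, y))%R.
Proof.
move=> mF; apply: (measurableT_comp (fine_measurable measurableT)) => //.
under eq_fun do rewrite integralE.
apply: emeasurable_funB.
- apply: eq_measurable_fun (measurable_fun_fubini_tonelli_F (m2 := P2) ((EFin \o
    F)^\+)%E _ _) => //.
    by move=> x _; apply: eq_integral => y _; rewrite !funeposE.
  by apply: measurable_funepos; exact/measurable_EFinP.
- apply: eq_measurable_fun (measurable_fun_fubini_tonelli_F (m2 := P2) ((EFin \o
    F)^\-)%E _ _) => //.
    by move=> x _; apply: eq_integral => y _; rewrite !funenegE.
  by apply: measurable_funeneg; exact/measurable_EFinP.
Qed.

(** If the integral of [f] is infinite or undefined, the real-valued integral takes the default
    value 0, so no integrability is assumed. *)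
Lemma normr_Rintegral_le (f : T2 -> R) : measurable_fun setT f ->
  (`|\int[P2]_y f y|%:E <= \int[P2]_y `|(f y)%:E|)%E.
Proof.
move=> mf; apply: le_trans (le_abse_integral P2 measurableT _); last first.
  exact/measurable_EFinP.
by rewrite /Rintegral; case: (integral _ _ _) => //= [|]; rewrite normr0 leey.
Qed.

(** Jensen's inequality for the inner integral. *)
Lemma Lnorm_fubini p (F : T1 * T2 -> R) : (1 <= p)%E ->
  measurable_fun [set: T1 * T2] F ->
  ('N[P1]_p[EFin \o (fun x => \int[P2]_y F (x, y))%R]
    <= 'N[(P1 \x P2)%E]_p[EFin \o F])%E.
Proof.
move=> p1 mF; have mI := measurable_fun_Rintegral mF.
have mFx x : measurable_fun setT (fun y => F (x, y)).
  by apply: measurableT_comp => //; exact: measurable_pair1.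
case: p p1 => [r||//] p1; rewrite unlock /Lnorm.
- rewrite lee_fin in p1; have r0 : 0 < r by apply: lt_le_trans p1.
  apply: gt0_ler_poweR; rewrite ?in_itv ?invr_ge0 ?(ltW r0)//=.
  + by rewrite integral_ge0 ?leey// => x _; rewrite poweR_ge0.
  + by rewrite integral_ge0 ?leey// => x _; rewrite poweR_ge0.
  rewrite fubini_tonelli1/=; [|exact: measurable_powR_norm|by move=> z;
    rewrite lee_fin powR_ge0].
  apply: ge0_le_integral => //=.
  + exact: measurable_powR_norm.
  + apply: (measurable_fun_fubini_tonelli_F (fun z => (`|F z| `^ r)%:E)).
      exact: measurable_powR_norm.
    by move=> z; rewrite lee_fin powR_ge0.
  move=> x _; rewrite /fubini_F.
  have -> : (\int[P2]_y (`|F (x, y)| `^ r)%:E =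
      'N[P2]_r%:E[EFin \o (fun y => F (x, y))] `^ r)%E.
    by rewrite poweR_Lnorm// gt_eqF.
  rewrite -poweR_EFin; apply: gt0_ler_poweR.
  + exact: ltW.
  + by rewrite in_itv/= lee_fin normr_ge0 leey.
  + by rewrite in_itv/= leey Lnorm_ge0.
  apply: le_trans (@Lnorm1_le _ _ _ P2 r%:E (fun y => F (x, y)) _ _) => //.
  exact: normr_Rintegral_le.
- have -> : (P1 : {measure set T1 -> \bar R}) setT = 1%E by exact: probability_setT.
  have -> : ((P1 \x P2)%E : {measure set _ -> \bar R}) setT = 1%E.
    by exact: probability_setT.
  rewrite lte01; set M := leRHS.
  (* Case p infinite: almost every section of [F] is almost everywhere bounded by the essential
     supremum [M], and averaging over a probability measure keeps this bound. *)
  have : \forall z \ae (P1 \x P2)%E, [set z | (`|(F z)%:E| <= M)%E] z.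
    exact: (ess_sup_ge (P1 \x P2)%E (abse \o (EFin \o F))).
  have mA : measurable [set z | (`|(F z)%:E| <= M)%E].
    rewrite -[X in measurable X]setTI; apply: measurable_lee => //.
    by apply: measurableT_comp => //; exact/measurable_EFinP.
  move=> /(ae_product mA) H; apply/ess_supP; apply: filterS H => x /= Hx.
  apply: le_trans (normr_Rintegral_le (mFx x)) _.
  apply: (@le_trans _ _ (\int[P2]_y M)%E); last first.
    by rewrite integral_cst//= probability_setT mule1.
  apply: ae_ge0_le_integral => //.
  + by do 2 apply: measurableT_comp => //.
  + move=> y _; apply: ess_sup_gee; last by apply: nearW => z /=.
    by rewrite (_ : _ setT = 1%E) ?lte01//; exact: probability_setT.
  + by apply: filterS Hx.
Qed.

End Lnorm_product.

Lemma Lnorm_distribution d d' (T : measurableType d) (T' : measurableType d')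
    (R : realType) (P : probability T R) (X : {mfun T >-> T'}) p (f : T' -> R) :
  (1 <= p)%E -> measurable_fun setT f ->
  ('N[distribution P X]_p[EFin \o f] = 'N[P]_p[EFin \o (f \o X)])%E.
Proof.
case: p => [r||//] p1 mf; rewrite !unlock /Lnorm.
- rewrite ge0_integral_distribution//.
    exact: measurable_powR_norm.
  by move=> y; rewrite lee_fin powR_ge0.
- have -> : (P : {measure set T -> \bar R}) setT = 1%E by exact: probability_setT.
  have -> : (distribution P X : {measure set T' -> \bar R}) setT = 1%E.
    by exact: probability_setT.
  rewrite lte01 !ess_supEmu0//.
  by do 3 apply: measurableT_comp => //.
  by do 2 apply: measurableT_comp => //.
Qed.

(** * The measure on the cube *)

Section boxes.
Context {R : realType}.

Definition box n (A : 'I_n -> set (measurableTypeR R)) : set (vec R n) :=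
  [set x | forall i, A i (tnth x i)].

Lemma measurable_box n (A : 'I_n -> set (measurableTypeR R)) :
  (forall i, measurable (A i)) -> measurable (box A).
Proof.
move=> mA; have -> : box A = \bigcap_(i in [set: 'I_n]) ((@tnth n R ^~ i) @^-1` A i).
  by apply/seteqP; split=> x xA i; [move=> _|]; exact: xA.
apply: fin_bigcap_measurable => // i _.
by rewrite -[X in measurable X]setTI; apply: measurable_tnth.
Qed.

Lemma measurable_vec_tnth n (i : 'I_n) :
  measurable_fun [set: vec R n] (fun x : vec R n => tnth x i : measurableTypeR R).
Proof. exact: measurable_tnth. Qed.

Lemma vec_lt_nat n (x : vec R n) : exists m : nat, forall i, tnth x i < m%:R.
Proof.
exists (Num.bound (\sum_i `|tnth x i|)) => i.
apply: le_lt_trans (archi_boundP _); last by apply: sumr_ge0.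
by rewrite (le_trans (ler_norm _))// (bigD1 i)//= lerDl sumr_ge0.
Qed.

(** The open lower orthants: a generating pi-system, chosen because on the half-open cube they cut
    out the boxes tested by the anchored kernels. *)
Definition rays n : set (set (vec R n)) :=
  [set box (fun i => `]-oo, a i[%classic) | a in [set: 'I_n -> R]].

Lemma rays_setI n : setI_closed (@rays n).
Proof.
move=> _ _ [a _ <-] [b _ <-]; exists (fun i => Order.min (a i) (b i)) => //.
apply/seteqP; split=> [x /= xab|x [/= xa xb] i].
  by split=> i; have := xab i; rewrite /= !in_itv/= lt_min => /andP[].
by have := xa i; have := xb i; rewrite /= !in_itv/= lt_min => -> ->.
Qed.

Lemma measurable_vecE n : (@measurable _ (vec R n)) = <<s @rays n >>.
Proof.
apply/seteqP; split=> [|]; last first.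
  apply: smallest_sub; first exact: sigma_algebra_measurable.
  by move=> _ [a _ <-]; apply: measurable_box => i.
apply: smallest_sub; first exact: smallest_sigma_algebra.
rewrite -bigcup_seq => B [i /= _ [C mC <-{B}]].
suff sC : measurable `<=` image_set_system setT (@tnth n (measurableTypeR R) ^~ i)
  <<s @rays n >>.
  exact: sC.
have -> : @measurable _ (measurableTypeR R) = <<s @RGenInftyO.G R >>.
  exact: RGenInftyO.measurableE.
apply: smallest_sub.
  by apply: sigma_algebra_image; exact: smallest_sigma_algebra.
move=> _ [a ->]; rewrite /image_set_system/= setTI.
(* A half-space is a countable union of orthants whose other coordinates are bounded by a growing
   integer m. *)
have -> : (@tnth n (measurableTypeR R) ^~ i) @^-1` `]-oo, a[%classic =
   \bigcup_m box (fun j => if j == i then `]-oo, a[%classic else `]-oo, m%:R[%classic).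
  apply/seteqP; split=> [x xa|x [m _ /(_ i)]]; last by rewrite eqxx.
  have [m xm] := vec_lt_nat x.
  by exists m => // j; case: eqP => [->|_] //; rewrite /= in_itv/= xm.
apply: sigma_algebra_bigcup => m; apply: sub_sigma_algebra.
exists (fun j => if j == i then a else m%:R) => //.
by congr box; apply/funext => j; case: eqP.
Qed.

Lemma vec_measure_unique n (m1 m2 : {measure set (vec R n) -> \bar R}) :
  (m1 setT < +oo)%E ->
  (forall a : 'I_n -> R,
    m1 (box (fun i => `]-oo, a i[%classic)) = m2 (box (fun i => `]-oo, a
      i[%classic))) ->
  forall B, measurable B -> m1 B = m2 B.
Proof.
move=> m1T m12 B mB; have mray (a : 'I_n -> R) :
    measurable (box (fun i => `]-oo, a i[%classic : set (measurableTypeR R))).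
  exact: measurable_box.
apply: (measure_unique (@rays n) (fun m => box (fun=> `]-oo, m%:R[%classic))) => //.
- exact: measurable_vecE.
- exact: rays_setI.
- by move=> m; exists (fun=> m%:R).
- apply/seteqP; split=> // x _; have [m xm] := vec_lt_nat x.
  by exists m => // i; rewrite /= in_itv/= xm.
- by move=> _ [a _ <-].
- by move=> m; apply: le_lt_trans m1T; apply: le_measure; rewrite ?inE.
Qed.

End boxes.

Section cube_measure_lemmas.
Context {R : realType}.

Lemma fin_unit_measure (A : set (measurableTypeR R)) : measurable A ->
  unit_measure A \is a fin_num.
Proof. by move=> mA; apply: fin_num_measure. Qed.

Lemma cube_measure_box n (A : 'I_n -> set (measurableTypeR R)) :
  (forall i, measurable (A i)) ->
  cube_measure n (box A) = (\prod_(i < n) fine (unit_measure (A i)))%:E.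
Proof.
elim: n A => [|n IH] A mA.
  rewrite big_ord0 /= diracE mem_set//; by case.
rewrite big_ord_recl EFinM -IH// fineK ?fin_unit_measure//.
rewrite -product_measure1E//; last exact: measurable_box.
congr (product_measure1 _ _ _).
apply/seteqP; split=> [[x y] /= xA|[x y] /= [A0 yA] i].
- split; first by have := xA ord0; rewrite /vcons tnth0.
  by move=> i; have := xA (lift ord0 i); rewrite /vcons tnthS.
- by case: (unliftP ord0 i) => [j|] ->; rewrite ?tnth0 ?tnthS//; exact: yA.
Qed.

End cube_measure_lemmas.

(** * Null sets and norms of measures that agree on measurable sets *)

Section eq_measure.
Context d (T : measurableType d) (R : realType).
Variables m1 m2 : {measure set T -> \bar R}.
Hypothesis m12 : forall A, measurable A -> m1 A = m2 A.

Lemma eq_measure_ae (A : set T) :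
  (\forall x \ae m1, A x) -> \forall x \ae m2, A x.
Proof. by move=> [N [mN N0 AN]]; exists N; split=> //; rewrite -m12. Qed.

End eq_measure.

Lemma eq_measure_Lnorm d (T : measurableType d) (R : realType)
    (m1 m2 : {measure set T -> \bar R}) p (f : T -> \bar R) :
  (forall A, measurable A -> m1 A = m2 A) -> (1 <= p)%E ->
  ('N[m1]_p[f] = 'N[m2]_p[f])%E.
Proof.
move=> m12; case: p => [r||//] p1; rewrite unlock /Lnorm.
  by rewrite (eq_measure_integral m2)// => A mA _; exact: m12.
rewrite m12//; case: ifPn => // _; congr ereal_inf.
by apply/seteqP; split=> y; apply: eq_measure_ae => // A mA; rewrite m12.
Qed.

(** * Restricting, extending and splicing coordinates *)

Section coordinates.
Context {R : realType} {s : nat}.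
Implicit Types (u v : {set 'I_s}).

(** The partial inverse of [enum_val], that is, the position of i in the increasing list of u. *)
Definition coord_rank u (i : 'I_s) : option 'I_#|u| := [pick k | enum_val k == i].

Lemma coord_rank_enum_val u (k : 'I_#|u|) : coord_rank u (enum_val k) = Some k.
Proof.
rewrite /coord_rank; case: pickP => [j /eqP /enum_val_inj ->//|/(_ k)].
by rewrite eqxx.
Qed.

Lemma coord_rank_notin u i : i \notin u -> coord_rank u i = None.
Proof.
rewrite /coord_rank; case: pickP => // k /eqP <-.
by rewrite enum_valP.
Qed.

(** [subpoint] with its arguments swapped, to be declared as a measurable
    function of the point. *)
Definition subpt u (x : vec R s) : vec R #|u| := subpoint x u.

(** The missing coordinates are set to the anchor 0, where the anchored kernel vanishes; uniqueness
    of anchored decompositions relies on this value. *)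
Definition extend u (z : vec R #|u|) : vec R s :=
  [tuple if coord_rank u i is Some k then tnth z k else 0 | i < s].

Arguments extend : clear implicits.

(** The point [x_v; y_w] with w the complement of v, for a pair (x, y) of points of the full space.
    It avoids product spaces indexed by v and by its complement. *)
Definition splice v (z : vec R s * vec R s) : vec R s :=
  [tuple if i \in v then tnth z.1 i else tnth z.2 i | i < s].

Lemma tnth_subpt u x k : tnth (subpt u x) k = tnth x (enum_val k).
Proof. by rewrite tnth_mktuple. Qed.

Lemma tnth_splice v z i : tnth (splice v z) i = if i \in v then tnth z.1 i else tnth
  z.2 i.
Proof. by rewrite tnth_mktuple. Qed.

Lemma tnth_extend_enum u z k : tnth (extend u z) (enum_val k) = tnth z k.
Proof. by rewrite tnth_mktuple coord_rank_enum_val. Qed.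

Lemma tnth_extend_notin u z i : i \notin u -> tnth (extend u z) i = 0.
Proof. by move=> iu; rewrite tnth_mktuple coord_rank_notin. Qed.

Lemma extendK u : cancel (extend u) (subpt u).
Proof.
by move=> z; apply: eq_from_tnth => k; rewrite tnth_subpt tnth_extend_enum.
Qed.

Lemma tnth_extend_subpt u x i : i \in u -> tnth (extend u (subpt u x)) i = tnth x i.
Proof.
by move=> iu; rewrite -(enum_rankK_in iu iu) tnth_extend_enum tnth_subpt.
Qed.

Lemma measurable_subpt u : measurable_fun setT (subpt u).
Proof.
apply/measurable_fun_tnthP => k.
apply: eq_measurable_fun (measurable_vec_tnth (enum_val k)) => x _.
by rewrite /= tnth_subpt.
Qed.

HB.instance Definition _ u :=
  isMeasurableFun.Build _ _ _ _ (subpt u) (@measurable_subpt u).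

Lemma measurable_extend u : measurable_fun setT (extend u).
Proof.
apply/measurable_fun_tnthP => i.
case E : (coord_rank u i) => [k|].
  apply: eq_measurable_fun (measurable_vec_tnth k) => x _.
  by rewrite /= tnth_mktuple E.
apply: eq_measurable_fun (@measurable_cst _ _ _ _ setT (0 : measurableTypeR R)) => x _.
by rewrite /= tnth_mktuple E.
Qed.

Lemma measurable_splice v : measurable_fun setT (splice v).
Proof.
apply/measurable_fun_tnthP => i.
case E : (i \in v).
  apply: eq_measurable_fun (measurableT_comp (measurable_vec_tnth i) measurable_fst)
    => x _.
  by rewrite /= tnth_splice E.
apply: eq_measurable_fun (measurableT_comp (measurable_vec_tnth i) measurable_snd)
  => x _.
by rewrite /= tnth_splice E.
Qed.

HB.instance Definition _ v :=
  isMeasurableFun.Build _ _ _ _ (splice v) (@measurable_splice v).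

Lemma cube_measure_unique n (m : {measure set (vec R n) -> \bar R}) :
  (forall A : 'I_n -> set (measurableTypeR R), (forall i, measurable (A i)) ->
    m (box A) = (\prod_(i < n) fine (unit_measure (A i)))%:E) ->
  forall B, measurable B -> cube_measure n B = m B.
Proof.
move=> mA; apply: vec_measure_unique => [|a].
  by rewrite [X in (X < _)%E](_ : _ = 1%E) ?ltry//; exact: probability_setT.
by rewrite mA//; apply: cube_measure_box.
Qed.

(** The preimage of a box is a box with full sides outside u, and those sides have mass 1. Integrals
    over [0, 1]^u can thus be taken over the whole cube. *)
Lemma distribution_subpt u B : measurable B ->
  distribution (cube_measure s) (subpt u) B = cube_measure #|u| B.
Proof.
move=> mB; symmetry; apply: (cube_measure_unique _ mB) => A mA.
pose C i := if coord_rank u i is Some k then A k else setT.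
have mC i : measurable (C i) by rewrite /C; case: coord_rank.
have E : subpt u @^-1` box A = box C.
  apply/seteqP; split=> [x xA i|x xC k].
    rewrite /C /coord_rank; case: pickP => // k /eqP <-.
    by have := xA k; rewrite tnth_subpt.
  by have := xC (enum_val k); rewrite /C coord_rank_enum_val tnth_subpt.
rewrite -[LHS]/(cube_measure s (subpt u @^-1` box A)) E cube_measure_box//
  (bigID (mem u))/= [X in _ * X]big1 => [|i iu].
  rewrite mulr1 big_enum_val/=; congr EFin; apply: eq_bigr => k _.
  by rewrite /C coord_rank_enum_val.
by rewrite /C coord_rank_notin// probability_setT.
Qed.

(** The preimage of a box is a product of two boxes, which constrain complementary sets of
    coordinates. *)
Lemma distribution_splice v B : measurable B ->
  distribution (cube_measure s \x cube_measure s)%E (splice v) B = cube_measure s B.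
Proof.
move=> mB; symmetry; apply: (cube_measure_unique _ mB) => A mA.
pose C (w : {set 'I_s}) i := if i \in w then A i else setT.
have mC w i : measurable (C w i) by rewrite /C; case: ifP.
have E : splice v @^-1` box A = box (C v) `*` box (C (~: v)).
  apply/seteqP; split=> [[x y] xA|[x y] /= [xC yC] i].
    by split=> i; have := xA i; rewrite tnth_splice/= /C ?inE; case: (i \in v).
  have := xC i; have := yC i.
  by rewrite tnth_splice/= /C inE; case: (i \in v).
rewrite -[LHS]/(product_measure1 (cube_measure s) (cube_measure s) (splice v @^-1`
  box A)) E.
transitivity (cube_measure s (box (C v)) * cube_measure s (box (C (~: v))))%E.
  by apply: product_measure1E; exact: measurable_box.
rewrite !cube_measure_box// -EFinM -big_split/=; congr EFin; apply: eq_bigr => i _.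
by rewrite /C inE; case: (i \in v); rewrite /= probability_setT ?mul1r ?mulr1.
Qed.

Lemma ae_half_open_cube n :
  \forall x \ae cube_measure n, [set x : vec R n | forall i, 0 <= tnth x i < 1] x.
Proof.
have mC : measurable (box (fun=> `[0, 1[%classic) : set (vec R n)).
  exact: measurable_box.
exists (~` box (fun=> `[0, 1[%classic)); split.
- exact: measurableC.
- rewrite [LHS]probability_setC// cube_measure_box// big1 ?subee// => i _.
  rewrite -[RHS]/(fine 1%E); congr fine.
  rewrite /unit_measure /mrestr setIidl; last first.
    by move=> x /=; rewrite !in_itv/= => /andP[-> /ltW].
  by rewrite lebesgue_measure_itv/= lte_fin ltr01 sube0.
- by move=> x /= nx xb; apply: nx => i; have := xb i; rewrite /= in_itv.
Qed.

Lemma ae_cube n : \forall x \ae cube_measure n, (cube : set (vec R n)) x.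
Proof.
by apply: filterS (ae_half_open_cube n) => x x01 i; have /andP[-> /ltW] := x01 i.
Qed.

End coordinates.
Arguments extend {R s} u z.

(** Integrability and additivity are proved together, since adding one term requires integrability
    of the remaining sum. *)
Lemma Rintegral_sum d (T : measurableType d) (R : realType)
    (mu : {measure set T -> \bar R}) I (r : seq I) (P : pred I) (F : I -> T -> R) :
  (forall i, P i -> mu.-integrable setT (EFin \o F i)) ->
  mu.-integrable setT (EFin \o (fun x => \sum_(i <- r | P i) F i x)) /\
  \int[mu]_x (\sum_(i <- r | P i) F i x) = \sum_(i <- r | P i) \int[mu]_x F i x.
Proof.
move=> iF; elim: r => [|i r [iS ES]].
  under [X in EFin \o X]eq_fun do rewrite big_nil.
  under eq_Rintegral do rewrite big_nil.
  by rewrite Rintegral_cst// mul0r big_nil; split=> //; exact: integrable0.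
under [X in EFin \o X]eq_fun do rewrite big_cons.
under eq_Rintegral do rewrite big_cons.
rewrite big_cons; case: ifPn => // Pi; split; last by rewrite RintegralD// ?ES//;
  exact: iF.
rewrite (_ : _ \o _ = (EFin \o F i) \+ (EFin \o (fun x => (\sum_(j <- r | P j) F j
  x)%R)))%E//.
by apply: integrableD => //; exact: iF.
Qed.

Lemma measurable_fun_prodr d (T : measurableType d) (R : realType)
    I (r : seq I) (P : pred I) (F : I -> T -> R) :
  (forall i, P i -> measurable_fun setT (F i)) ->
  measurable_fun setT (fun x => \prod_(i <- r | P i) F i x).
Proof.
move=> mF; elim: r => [|i r IH].
  by under eq_fun do rewrite big_nil; exact: measurable_cst.
under eq_fun do rewrite big_cons.
case Pi : (P i) => //.
by apply: measurable_funM => //; exact: mF.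
Qed.

(** * Change of variables along a measure-preserving map *)

Section measure_preserving.
Context d d' (T : measurableType d) (T' : measurableType d') (R : realType).
Variables (P : probability T R) (Q : probability T' R) (X : {mfun T >-> T'}).
Hypothesis PQ : forall B, measurable B -> distribution P X B = Q B.

Lemma preserving_integral (f : T' -> \bar R) : measurable_fun setT f ->
  (\int[Q]_z f z = \int[P]_x f (X x))%E.
Proof.
move=> mf.
rewrite (eq_measure_integral (distribution P X)) => [|A mA _]; last exact/esym/PQ.
rewrite integralE [RHS]integralE; congr (_ - _)%E.
- rewrite ge0_integral_distribution//; last exact: measurable_funepos.
  by apply: eq_integral => x _; rewrite /= !funeposE.
- rewrite ge0_integral_distribution//; last exact: measurable_funeneg.
  by apply: eq_integral => x _; rewrite /= !funenegE.
Qed.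

Lemma preserving_Rintegral (f : T' -> R) : measurable_fun setT f ->
  \int[Q]_z f z = \int[P]_x f (X x).
Proof.
by move=> mf; rewrite /Rintegral preserving_integral//; exact/measurable_EFinP.
Qed.

Lemma preserving_integrable (f : T' -> R) :
  Q.-integrable setT (EFin \o f) -> P.-integrable setT (EFin \o (f \o X)).
Proof.
move=> /integrableP[mf fi]; apply/integrableP; split.
  by apply/measurable_EFinP; apply: measurableT_comp => //; exact/measurable_EFinP.
rewrite -(preserving_integral (f := fun z => `|(f z)%:E|%E))//.
exact: measurableT_comp.
Qed.

Lemma preserving_Lnorm p (f : T' -> R) : (1 <= p)%E -> measurable_fun setT f ->
  ('N[Q]_p[EFin \o f] = 'N[P]_p[EFin \o (f \o X)])%E.
Proof.
move=> p1 mf; rewrite -Lnorm_distribution//.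
by apply: eq_measure_Lnorm => // A mA; exact/esym/PQ.
Qed.

Lemma preserving_ae (A : set T') : (\forall z \ae Q, A z) ->
  \forall x \ae P, A (X x).
Proof.
move=> [N [mN N0 AN]]; exists (X @^-1` N); split.
- by rewrite -[X in measurable X]setTI; exact: measurable_funP.
- by rewrite -N0; exact: (PQ mN).
- by move=> x /= nA; exact: AN.
Qed.

End measure_preserving.

Lemma ae_le1_integrable d (T : measurableType d) (R : realType)
    (P : probability T R) (f w : T -> R) :
  P.-integrable setT (EFin \o f) -> measurable_fun setT w ->
  (\forall x \ae P, `|w x| <= 1) ->
  P.-integrable setT (EFin \o (fun x => f x * w x)).
Proof.
move=> /Lfun1_integrable/Lfun_inP[mf Nf] mw w1; apply/Lfun1_integrable/Lfun_inP.
have mfw : measurable_fun setT (fun x => f x * w x) by exact: measurable_funM.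
split=> //; apply: le_lt_trans Nf; apply: ae_le_Lnorm => //.
by apply: filterS w1 => x wx; rewrite normrM ler_piMr.
Qed.

(** * Components and their partial integrals *)

Section unit_bounded.
Context {R : realType}.

(** The bound is required on [0, 1] only: 1 - t and the ANOVA kernel are unbounded on the line, but
    [cube_measure] ignores the outside of the cube. *)
Definition unit_bounded (f : R -> R) : Prop :=
  measurable_fun [set: measurableTypeR R] (f : measurableTypeR R -> measurableTypeR R)
  /\ forall t, 0 <= t <= 1 -> `|f t| <= 1.

Variables (s : nat) (f : 'I_s -> R -> R).
Hypothesis fb : forall i, unit_bounded (f i).

Lemma measurable_prod_coord (A : {set 'I_s}) :
  measurable_fun setT (fun t : vec R s => \prod_(i in A) f i (tnth t i)).
Proof.
apply: measurable_fun_prodr => i _.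
apply: (measurableT_comp (fb i).1); exact: measurable_vec_tnth.
Qed.

Lemma prod_coord_le1 (A : {set 'I_s}) (t : vec R s) : cube t ->
  `|\prod_(i in A) f i (tnth t i)| <= 1.
Proof.
move=> ct; rewrite normr_prod prodr_ile1// => i _.
by rewrite normr_ge0/= (fb i).2.
Qed.

Lemma integrable_prod_coord (A : {set 'I_s}) (h : vec R s -> R) :
  (cube_measure s).-integrable setT (EFin \o h) ->
  (cube_measure s).-integrable setT
    (EFin \o (fun t => h t * \prod_(i in A) f i (tnth t i))).
Proof.
move=> hi; apply: ae_le1_integrable => //; first exact: measurable_prod_coord.
by apply: filterS (ae_cube s) => t; exact: prod_coord_le1.
Qed.

End unit_bounded.

Section component_lemmas.
Context {R : realType} {s : nat}.
Implicit Types (u v : {set 'I_s}) (x : vec R s).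

Lemma component_lift (k : R -> R -> R) u (h : vec R #|u| -> R) x :
  (forall y, unit_bounded (k y)) -> measurable_fun setT h ->
  component k h x =
  \int[cube_measure s]_t (h (subpt u t) * \prod_(i in u) k (tnth x i) (tnth t i)).
Proof.
move=> kb mh; rewrite /component (preserving_Rintegral (@distribution_subpt R s u)).
  apply: eq_Rintegral => t _; rewrite [in RHS]big_enum_val/=.
  by congr (_ * _); apply: eq_bigr => i _; rewrite -/(subpt u x) !tnth_subpt.
apply: measurable_funM => //; apply: measurable_fun_prodr => i _.
by apply: (measurableT_comp (kb _).1); exact: measurable_vec_tnth.
Qed.

End component_lemmas.

(** * Integrating out the coordinates outside v *)

Section partial_integral.
Context {R : realType} {s : nat}.
Implicit Types (u v : {set 'I_s}) (x t y : vec R s) (c : R -> R).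

Notation mu := (@cube_measure R s).

Lemma splice_extend v (z : vec R #|v|) t y :
  subpt v t = z -> splice v (extend v z, y) = splice v (t, y).
Proof.
move=> <-; apply: eq_from_tnth => i; rewrite !tnth_splice/=.
by case: ifPn => // iv; rewrite tnth_extend_subpt.
Qed.

Definition integrand c u v (h : vec R #|u| -> R) (z : vec R s * vec R s) : R :=
  h (subpt u (splice v z)) * \prod_(i in u :\: v) c (tnth z.2 i).

(** The integral of h_u(z_v, y) times the product of c(y_j) over j in u - v. Here y runs over the
    whole cube, the surplus coordinates contributing a factor 1, and the zeros supplied by [extend]
    are never read by [splice]. *)
Definition partial_integral c u v (h : vec R #|u| -> R) (z : vec R #|v|) : R :=
  \int[mu]_y integrand c v h (extend v z, y).

Lemma partial_integral_subpt c u v (h : vec R #|u| -> R) t :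
  partial_integral c h (subpt v t) = \int[mu]_y integrand c v h (t, y).
Proof.
by apply: eq_Rintegral => y _; rewrite /integrand (splice_extend _ (erefl _)).
Qed.

Variables (c : R -> R) (cb : unit_bounded c).

Lemma measurable_integrand u v (h : vec R #|u| -> R) :
  measurable_fun setT h -> measurable_fun setT (integrand c v h).
Proof.
move=> mh; apply: measurable_funM.
  apply: (measurableT_comp mh).
  by apply: (measurableT_comp (@measurable_subpt R s u)); exact: measurable_splice.
apply: measurable_fun_prodr => i _; apply: (measurableT_comp cb.1).
by apply: (measurableT_comp (measurable_vec_tnth i)); exact: measurable_snd.
Qed.

Lemma measurable_partial_integral u v (h : vec R #|u| -> R) :
  measurable_fun setT h -> measurable_fun setT (partial_integral c h : vec R #|v| -> R).
Proof.
move=> mh.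
have := measurable_fun_Rintegral mu (measurable_integrand v mh).
move=> /measurableT_comp; apply; exact: measurable_extend.
Qed.

Lemma ae_cube_pair : \forall z \ae (mu \x mu)%E,
  (cube : set (vec R s)) z.1 /\ (cube : set (vec R s)) z.2.
Proof.
(* splicing along the empty and the full set gives the two projections *)
have H v := preserving_ae (@distribution_splice R s v) (ae_cube s).
move: (H finset.set0) (H (finset.setTfor _)); apply: filterS2 => z /= H2 H1.
by split=> i; [have := H1 i|have := H2 i]; rewrite tnth_splice !inE.
Qed.

(** Splicing two independent uniform points gives a uniform point, and the factors [c] are at most 1
    in absolute value on the cube. *)
Lemma Lnorm_integrand p u v (h : vec R #|u| -> R) :
  (1 <= p)%E -> measurable_fun setT h ->
  ('N[(mu \x mu)%E]_p[EFin \o integrand c v h] <= 'N[cube_measure #|u|]_p[EFin \o h])%E.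
Proof.
move=> p1 mh.
rewrite (preserving_Lnorm (@distribution_subpt R s u))//.
have mhu := measurableT_comp mh (@measurable_subpt R s u).
rewrite (preserving_Lnorm (@distribution_splice R s v))//.
apply: ae_le_Lnorm => //.
- exact: measurable_integrand.
- exact: (measurableT_comp mhu (@measurable_splice R s v)).
apply: filterS ae_cube_pair => -[t y] /= [_ cy].
by rewrite normrM ler_piMr// (@prod_coord_le1 R s (fun=> c)).
Qed.

Lemma Lnorm_partial_integral p u v (h : vec R #|u| -> R) :
  (1 <= p)%E -> measurable_fun setT h ->
  ('N[cube_measure #|v|]_p[EFin \o (partial_integral c h : vec R #|v| -> R)]
   <= 'N[cube_measure #|u|]_p[EFin \o h])%E.
Proof.
move=> p1 mh; apply: le_trans (Lnorm_integrand v p1 mh).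
rewrite (preserving_Lnorm (@distribution_subpt R s v))//; last first.
  exact: measurable_partial_integral.
rewrite (_ : _ \o _ = fun t => \int[mu]_y integrand c v h (t, y)).
  by apply: Lnorm_fubini => //; exact: measurable_integrand.
by apply/funext => t; rewrite /= partial_integral_subpt.
Qed.

Lemma Lfun_partial_integral p u v (h : vec R #|u| -> R) :
  (1 <= p)%E -> h \in Lfun (cube_measure #|u|) p ->
  (partial_integral c h : vec R #|v| -> R) \in Lfun (cube_measure #|v|) p.
Proof.
move=> p1 /Lfun_inP[mh Nh]; apply/Lfun_inP; split.
  exact: measurable_partial_integral.
exact: le_lt_trans (Lnorm_partial_integral _ _ _) Nh.
Qed.

Lemma prodr_subset_expand (I : finType) (u : {set I}) (a b : I -> R) :
  \prod_(i in u) (a i + b i) =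
  \sum_(v : {set I} | v \subset u)
    (\prod_(i in v) a i * \prod_(i in u :\: v) b i).
Proof.
rewrite big_mkcond/=.
(* Outside u the factor is written 0 + 1, so that in the expansion over all subsets v those not
   contained in u drop out. *)
transitivity (\prod_i ((if i \in u then a i else 0) + (if i \in u then b i else 1))).
  by apply: eq_bigr => i _; case: ifP => _ //; rewrite add0r.
rewrite bigA_distr [RHS]big_mkcond/=; apply: eq_bigr => v _.
case: ifPn => [vu|/fintype.subsetPn[i iv iu]]; last first.
  by rewrite (bigD1 i)//= iv (negbTE iu) mul0r.
rewrite [X in _ = X * _]big_mkcond [X in _ = _ * X]big_mkcond -big_split/=.
apply: eq_bigr => i _; rewrite inE; case: ifPn => iv /=; last by rewrite mul1r.
by rewrite (fintype.subsetP vu)// mulr1.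
Qed.

Variables (k1 k2 : R -> R -> R).
Hypotheses (k1b : forall r, unit_bounded (k1 r)) (k2b : forall r, unit_bounded (k2 r)).
Hypothesis k12 : forall r a, k1 r a = k2 r a + c a.

(** Fubini after the substitution of [splice v (t, y)] for the integration variable: the kernels
    [k2] then depend on t alone, the factors [c] on y alone, and integrating over y first produces
    the partial integral. *)
Lemma integral_partial u v (h : vec R #|u| -> R) x : v \subset u ->
  (cube_measure #|u|).-integrable setT (EFin \o h) ->
  let G t := h (subpt u t) *
    (\prod_(i in v) k2 (tnth x i) (tnth t i) * \prod_(i in u :\: v) c (tnth t i)) in
  mu.-integrable setT (EFin \o G) /\
  \int[mu]_t G t = component k2 (partial_integral c h : vec R #|v| -> R) x.
Proof.
move=> vu hi G.
have mh : measurable_fun setT h by apply/measurable_EFinP; case/integrableP : hi.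
have iG : mu.-integrable setT (EFin \o G).
  (* One family of one-variable factors covers both products, so integrability follows from the
     bound for a single product. *)
  pose phi i := if i \in v then k2 (tnth x i) else c.
  have phib i : unit_bounded (phi i) by rewrite /phi; case: ifP.
  have := integrable_prod_coord phib u (preserving_integrable (@distribution_subpt R
    s u) hi).
  congr (_.-integrable _ (_ \o _)); apply/funext => t; congr (_ * _).
  rewrite (big_setID v)/= (finset.setIidPr vu); congr (_ * _); apply: eq_bigr => i.
    by rewrite /phi => ->.
  by rewrite /phi inE => /andP[/negbTE ->].
split=> //.
have mG : measurable_fun setT G by apply/measurable_EFinP; case/integrableP : iG.
have iGm := preserving_integrable (@distribution_splice R s v) iG.
have mp := @measurable_partial_integral u v h mh.
rewrite component_lift// (preserving_Rintegral (@distribution_splice R s v))//.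
rewrite /Rintegral; congr fine.
rewrite -[LHS](integral12_prod_meas1 iGm).
have iint : (mu \x mu)%E.-integrable setT (EFin \o integrand c v h).
  apply/Lfun1_integrable/Lfun_inP; split; first exact: measurable_integrand.
  move/Lfun1_integrable/Lfun_inP : hi => [_]; apply: le_lt_trans.
  exact: Lnorm_integrand.
apply: ae_eq_integral => //.
- exact: (measurable_int _ (integrable_fubini_F iGm)).
- apply/measurable_EFinP; apply: measurable_funM.
    exact: (measurableT_comp mp (@measurable_subpt R s v)).
  exact: (measurable_prod_coord (fun i => k2b (tnth x i))).
(* For almost every t the inner integrand is integrable in y, so the product of the [k2] may be
   moved under the integral. *)
apply: filterS (ae_integrable1 iint) => t it _.
rewrite /fubini_F /= partial_integral_subpt mulrC -RintegralZl//.
rewrite /Rintegral fineK; last first.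
  apply: integrable_fin_num => //.
  exact: (integrableZl measurableT _ it).
apply: eq_integral => y _; congr EFin.
rewrite /integrand /G mulrCA; congr (_ * (_ * _)).
  by apply: eq_bigr => i iv; rewrite tnth_splice iv.
by apply: eq_bigr => i; rewrite inE => /andP[iv _]; rewrite tnth_splice (negbTE iv).
Qed.

Lemma component_expand u (h : vec R #|u| -> R) x :
  (cube_measure #|u|).-integrable setT (EFin \o h) ->
  component k1 h x =
  \sum_(v : {set 'I_s} | v \subset u)
    component k2 (partial_integral c h : vec R #|v| -> R) x.
Proof.
move=> hi.
have mh : measurable_fun setT h by apply/measurable_EFinP; case/integrableP : hi.
rewrite component_lift//.
under eq_Rintegral do
  (under eq_bigr do rewrite k12; rewrite prodr_subset_expand mulr_sumr).
rewrite (Rintegral_sum _ _).2 => [|v vu]; last by have [] := integral_partial x vu hi.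
by apply: eq_bigr => v vu; have [] := integral_partial x vu hi.
Qed.

End partial_integral.

(** * Uniqueness of the decompositions *)

Section kernels.
Context {R : realType}.

Lemma integrable_prod_kernel n (k : R -> R -> R) (h : vec R n -> R) (x : vec R n) :
  (forall y, unit_bounded (k y)) ->
  (cube_measure n).-integrable setT (EFin \o h) ->
  (cube_measure n).-integrable setT
    (EFin \o (fun t => h t * \prod_(i < n) k (tnth x i) (tnth t i))).
Proof.
move=> kb hi.
have := integrable_prod_coord (fun i => kb (tnth x i)) (finset.setTfor _) hi.
congr (_.-integrable _ (_ \o _)); apply/funext => t; congr (_ * _).
by apply: eq_bigl => i; rewrite inE.
Qed.

Lemma anchored_kernel_bounded (x : R) : unit_bounded (anchored_kernel x).
Proof.
split; first exact: measurable_indic.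
by move=> t _; rewrite /anchored_kernel indicE; case: (_ \in _);
  rewrite ?normr1 ?normr0.
Qed.

Lemma measurable_onem : measurable_fun setT (fun t : measurableTypeR R => 1 - t :
  measurableTypeR R).
Proof. by apply: measurable_funB => //; exact: measurable_cst. Qed.

Lemma onem_bounded : unit_bounded (fun t : R => 1 - t).
Proof.
split; first exact: measurable_onem.
by move=> t /andP[t0 t1]; rewrite ler_norml; apply/andP; split; lra.
Qed.

Lemma opp_onem_bounded : unit_bounded (fun t : R => - (1 - t)).
Proof.
split; first by apply: measurable_funN; exact: measurable_onem.
by move=> t /onem_bounded.2; rewrite normrN.
Qed.

Lemma anova_kernel_bounded (x : R) : unit_bounded (anova_kernel x).
Proof.
split; first by apply: measurable_funB;
  [exact: measurable_indic|exact: measurable_onem].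
move=> t /andP[t0 t1]; rewrite /anova_kernel indicE ler_norml.
by case: (_ \in _) => /=; apply/andP; split; lra.
Qed.

End kernels.

(** * Functions whose integrals over all anchored boxes vanish *)

Section anchored_boxes.
Context {R : realType}.
Variable n : nat.
Notation mu := (@cube_measure R n).

Variable g : vec R n -> R.
Hypothesis gi : mu.-integrable setT (EFin \o g).
Hypothesis g0 : forall z, cube z ->
  \int[mu]_t (g t * \prod_(i < n) anchored_kernel (tnth z i) (tnth t i)) = 0.

Lemma integral_rays_eq0 (a : 'I_n -> R) :
  (\int[mu]_(t in box (fun i => `]-oo, a i[%classic)) (g t)%:E = 0)%E.
Proof.
(* The corner [a] is clipped to [0, 1]. For t in the half-open cube, t_i < z_i exactly when t_i <
   a_i, so the product of kernels is the indicator of the orthant. *)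
pose z : vec R n := [tuple Order.max 0 (Order.min (a i) 1) | i < n].
have cz : cube z.
  move=> i; rewrite tnth_mktuple le_max lexx/= ge_max ler01/=.
  by rewrite ge_min lexx orbT.
have mg : measurable_fun setT g by apply/measurable_EFinP; case/integrableP : gi.
have mB : measurable (box (fun i => `]-oo, a i[%classic : set (measurableTypeR R))).
  exact: measurable_box.
have zi : mu.-integrable setT (EFin \o (fun t => g t * \prod_(i < n) anchored_kernel
  (tnth z i) (tnth t i))).
  exact: integrable_prod_kernel anchored_kernel_bounded gi.
rewrite -[RHS]/((0 : R)%:E) -(g0 cz) /Rintegral fineK ?integrable_fin_num//.
rewrite [LHS]integral_mkcond; apply: ae_eq_integral => //.
- apply/(measurable_restrictT (EFin \o g)) => //.
  by apply/measurable_EFinP; exact: measurable_funTS.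
- by case/integrableP: zi.
apply: filterS (ae_half_open_cube n) => t t01 _; rewrite patchE.
have kE i : anchored_kernel (tnth z i) (tnth t i) = (tnth t i < a i)%R%:R.
  rewrite /anchored_kernel indicE mem_setE in_itv/= tnth_mktuple.
  have /andP[-> t1] := t01 i; rewrite /= lt_max lt_min t1 andbT.
  by rewrite ltNge; have /andP[-> _] := t01 i.
under [X in _ = (_ * X)%:E]eq_bigr do rewrite kE.
case: ifPn => [|]; rewrite ?inE ?notin_setE /box/=.
  move=> tB; rewrite big1 ?mulr1// => i _.
  by have := tB i; rewrite in_itv/= => ->.
move=> /existsNP[i ti]; rewrite (bigD1 i)//=.
by move: ti; rewrite in_itv/= => /negP/negbTE ->; rewrite mul0r mulr0.
Qed.

(** The sets over which [g] integrates to 0 form a Dynkin system containing the pi-system of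
    orthants, hence include all measurable sets. *)
Lemma anchored_integral_eq0 : \forall t \ae mu, g t = 0.
Proof.
have mg : measurable_fun setT g by apply/measurable_EFinP; case/integrableP : gi.
have giS (B : set (vec R n)) : measurable B -> mu.-integrable B (EFin \o g).
  by move=> mB; apply: integrableS gi.
pose Z (B : set (vec R n)) := (\int[mu]_(t in B) (g t)%:E = 0)%E.
(* Up to a null set, the whole space is the orthant with all corners equal to 1. *)
have ZT : Z setT.
  rewrite /Z -[RHS](integral_rays_eq0 (fun=> 1)) [RHS]integral_mkcond.
  apply: ae_eq_integral => //.
  - exact/measurable_EFinP.
  - apply/(measurable_restrictT (EFin \o g)) => //.
      exact: measurable_box.
    by apply/measurable_EFinP; exact: measurable_funTS.
  - apply: filterS (ae_half_open_cube n) => t t01 _.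
    rewrite patchE mem_set// => i; rewrite /= in_itv/=.
    by case/andP: (t01 i).
have Zall B : measurable B -> Z B.
  rewrite measurable_vecE; move: B; apply: (@dynkin_induction _ _ (@rays R n) Z).
  - exact: measurable_vecE.
  - exact: rays_setI.
  - exact: ZT.
  - by move=> _ [a _ <-]; exact: integral_rays_eq0.
  - move=> B mB ZB; have := ZT; rewrite /Z -(setvU B) integral_setU//.
    + by rewrite ZB adde0.
    + exact: measurableC.
    + by apply/measurable_EFinP; exact: measurable_funTS.
    + by apply/disj_setPS => x [].
  - move=> F mF tF ZF; rewrite /Z integral_bigcup//.
      by rewrite eseries0// => i _ _; exact: ZF.
    by apply: giS; exact: bigcupT_measurable.
have : ae_eq mu setT (EFin \o g) (cst 0%E).
  apply: integral_ae_eq => // B _ mB.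
  by rewrite [LHS]Zall// integral0.
by apply: filterS => t /(_ I) [].
Qed.

End anchored_boxes.

Lemma Lfun_sum d (T : measurableType d) (R : realType)
    (mu : {measure set T -> \bar R}) p I (r : seq I) (P : pred I) (F : I -> T -> R) :
  (1 <= p)%E -> (forall i, P i -> F i \in Lfun mu p) ->
  (fun x => \sum_(i <- r | P i) F i x) \in Lfun mu p.
Proof.
move=> p1 LF; have [L0 LD] := Lfun_addr_closed mu p1.
elim: r => [|i r IH].
  by under eq_fun do rewrite big_nil; exact: L0.
under eq_fun do rewrite big_cons.
by case Pi : (P i) => //; apply: LD => //; exact: LF.
Qed.

Lemma Lfun_sub d (T : measurableType d) (R : realType)
    (mu : {measure set T -> \bar R}) p (f g : T -> R) : (1 <= p)%E ->
  f \in Lfun mu p -> g \in Lfun mu p -> (fun x => f x - g x) \in Lfun mu p.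
Proof.
move=> p1 Lf Lg; have [_ LD] := Lfun_addr_closed mu p1.
by apply: LD => //; exact: Lfun_oppr_closed.
Qed.

(** * Passing between the two decompositions, and their uniqueness *)

Section decompositions.
Context {R : realType} {s : nat}.
Implicit Types (u v : {set 'I_s}) (x : vec R s) (gamma : {set 'I_s} -> R).
Implicit Types (k : R -> R -> R).

Lemma component_sum k u I (r : seq I) (P : pred I) (F : I -> vec R #|u| -> R) x :
  (forall y, unit_bounded (k y)) ->
  (forall i, P i -> (cube_measure #|u|).-integrable setT (EFin \o F i)) ->
  component k (fun z => \sum_(i <- r | P i) F i z) x =
  \sum_(i <- r | P i) component k (F i) x.
Proof.
move=> kb iF; rewrite /component.
under eq_Rintegral do rewrite mulr_suml.
rewrite (Rintegral_sum _ _).2// => i Pi.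
exact: (integrable_prod_kernel (subpoint x u) kb (iF i Pi)).
Qed.

Lemma component_sub k u (f g : vec R #|u| -> R) x :
  (forall y, unit_bounded (k y)) ->
  (cube_measure #|u|).-integrable setT (EFin \o f) ->
  (cube_measure #|u|).-integrable setT (EFin \o g) ->
  component k (fun z => f z - g z) x = component k f x - component k g x.
Proof.
move=> kb fi gi; rewrite /component -RintegralB//.
- by apply: eq_Rintegral => t _; rewrite mulrBl.
- exact: (integrable_prod_kernel (subpoint x u) kb fi).
- exact: (integrable_prod_kernel (subpoint x u) kb gi).
Qed.

Lemma component_ae0 k u (f : vec R #|u| -> R) x :
  (forall y, unit_bounded (k y)) -> measurable_fun setT f ->
  (\forall t \ae cube_measure #|u|, f t = 0) -> component k f x = 0.
Proof.
move=> kb mf f0; rewrite /component /Rintegral (ae_eq_integral (cst 0%E))//.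
- by rewrite integral0.
- apply/measurable_EFinP; apply: measurable_funM => //.
  apply: measurable_fun_prodr => i _; apply: (measurableT_comp (kb _).1).
  exact: measurable_vec_tnth.
- by apply: filterS f0 => t -> _; rewrite mul0r.
Qed.

(** With c(t) = 1 - t this maps anchored coefficients to ANOVA coefficients, with c(t) = - (1 - t)
    it maps back. *)
Definition transform (c : R -> R) gamma (h : coef_family) : coef_family :=
  fun v z => \sum_(u : {set 'I_s} | (0 < gamma u) && (v \subset u))
    partial_integral c (h u) z.

Lemma Lfun_transform c p gamma (h : coef_family) v : unit_bounded c -> (1 <= p)%E ->
  (forall u, 0 < gamma u -> h u \in Lfun (cube_measure #|u|) p) ->
  (transform c gamma h : coef_family) v \in Lfun (cube_measure #|v|) p.
Proof.
move=> cb p1 Lh; apply: Lfun_sum => // u /andP[u0 _].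
by apply: Lfun_partial_integral => //; exact: Lh.
Qed.

Definition down_closed gamma : Prop :=
  forall u v, v \subset u -> 0 < gamma u -> 0 < gamma v.

(** Expand every component by k1 = k2 + c and collect, for each v, the contributions of all u
    containing v; by [down_closed] every such v has positive weight and is a legitimate index. *)
Lemma transform_decomposition k1 k2 c p gamma f (h : coef_family) :
  unit_bounded c -> (forall y, unit_bounded (k1 y)) ->
  (forall y, unit_bounded (k2 y)) -> (forall y t, k1 y t = k2 y t + c t) ->
  (1 <= p)%E -> down_closed gamma ->
  decomposition k1 p gamma f h -> decomposition k2 p gamma f (transform c gamma h).
Proof.
move=> cb k1b k2b k12 p1 dc [Lh fE].
split=> [v _|x cx]; first exact: Lfun_transform.
rewrite fE//.
under eq_bigr => u u0 do
  rewrite (component_expand cb k1b k2b k12 x (Lfun_prob_integrable p1 (Lh u u0))).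
rewrite (exchange_big_dep (fun v => 0 < gamma v))/=; last first.
  by move=> u v u0 /dc; exact.
apply: eq_bigr => v v0; rewrite component_sum// => u /andP[u0 _].
apply: (Lfun_prob_integrable p1); apply: Lfun_partial_integral => //; exact: Lh.
Qed.

(** Uniqueness by linearity: the zero function has only the zero decomposition. Mere integrability
    of the coefficients makes the notion independent of p. *)
Definition unique_components k gamma : Prop :=
  forall d : @coef_family R s,
  (forall u, 0 < gamma u -> (cube_measure #|u|).-integrable setT (EFin \o d u)) ->
  (forall x, cube x -> \sum_(u : {set 'I_s} | 0 < gamma u) component k (d u) x = 0) ->
  forall u, 0 < gamma u -> \forall t \ae cube_measure #|u|, d u t = 0.

(** Some i in v - u has x_i = 0, and [0, 0) is empty, so one kernel factor vanishes. *)
Lemma anchored_component_notin u v (h : vec R #|v| -> R) (z : vec R #|u|) :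
  ~~ (v \subset u) -> component anchored_kernel h (extend u z) = 0.
Proof.
move=> /fintype.subsetPn[i iv iu].
rewrite /component -[RHS](mul0r (fine (cube_measure #|v| setT))) -Rintegral_cst//.
apply: eq_Rintegral => t _.
rewrite (bigD1 (enum_rank_in iv i))//= -/(subpt v _) tnth_subpt enum_rankK_in//.
rewrite tnth_extend_notin// /anchored_kernel indicE mem_setE in_itv/=.
by rewrite ltNge andbN mul0r mulr0.
Qed.

(** Strong induction on the cardinality of u. At [extend u z] only subsets of u contribute; the
    proper ones vanish by induction, which leaves the integral of [d u] over the box [0, z). *)
Lemma anchored_unique gamma : down_closed gamma -> unique_components anchored_kernel
  gamma.
Proof.
move=> dc d di d0 u; have [n] := ubnP #|u|; elim: n u => // n IH u un u0.
apply: (anchored_integral_eq0 (di u u0)) => z cz.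
have cx : cube (extend u z).
  move=> i; rewrite tnth_mktuple; case: coord_rank => [j|]; first exact: cz.
  by rewrite lexx ler01.
have := d0 _ cx; rewrite (bigD1 u)//= big1 ?addr0; last first.
  move=> v /andP[v0 vu]; have [vsu|] := boolP (v \subset u); last first.
    exact: anchored_component_notin.
  apply: component_ae0 => //; first exact: anchored_kernel_bounded.
    by apply/measurable_EFinP; case/integrableP : (di v v0).
  apply: IH => //; rewrite ltnS in un; apply: leq_trans un.
  by apply: proper_card; rewrite finset.properEneq vu.
move=> <-; apply: eq_Rintegral => t _; congr (_ * _); apply: eq_bigr => i _.
by rewrite -/(subpt u _) extendK.
Qed.

Lemma partial_integral_id c v (h : vec R #|v| -> R) :
  partial_integral c h = h.
Proof.
apply/funext => z; rewrite /partial_integral.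
have E y : integrand c v h (extend v z, y) = h z.
  rewrite /integrand finset.setDv big_set0 mulr1; congr h.
  apply: eq_from_tnth => i.
  by rewrite tnth_subpt tnth_splice enum_valP tnth_extend_enum.
under eq_Rintegral do rewrite E.
by rewrite Rintegral_cst// [X in fine X]probability_setT mulr1.
Qed.

(** The L_1 norm of the partial integral is at most that of [h], which is 0. *)
Lemma partial_integral_ae0 c u v (h : vec R #|u| -> R) : unit_bounded c ->
  measurable_fun setT h -> (\forall t \ae cube_measure #|u|, h t = 0) ->
  \forall t \ae cube_measure #|v|, partial_integral c h t = 0.
Proof.
move=> cb mh h0.
have mp : measurable_fun setT (partial_integral c h : vec R #|v| -> R).
  exact: measurable_partial_integral.
have N0 : ('N[cube_measure #|v|]_1[EFin \o (partial_integral c h : vec R #|v| -> R)]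
  = 0)%E.
  apply/eqP; rewrite eq_le Lnorm_ge0 andbT.
  apply: (le_trans (Lnorm_partial_integral cb v (lexx 1%E) mh)).
  rewrite (ae_eq_Lnorm (g := cst 0))// (_ : EFin \o cst 0 = cst 0%E)// Lnorm0//.
have H : EFin \o (partial_integral c h : vec R #|v| -> R) = \0%E %[ae cube_measure
  #|v|].
  by apply: Lnorm_eq0_eq0 N0 => //; exact/measurable_EFinP.
by apply: filterS H => t /(_ I) [].
Qed.

(** The top term of [transform c gamma d] at [u] is [d u] itself, hence the
    downward induction on [u]. *)
Lemma anova_unique gamma : down_closed gamma -> unique_components anova_kernel gamma.
Proof.
move=> dc d di d0.
pose c (t : R) := - (1 - t).
have dec : decomposition anova_kernel 1%E gamma (fun=> 0) d.
  split=> [u u0|x cx]; first by apply/Lfun1_integrable; exact: di.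
  by rewrite d0.
have cb : unit_bounded c := opp_onem_bounded.
(* The backward expansion gives an anchored decomposition of the zero function, so all transformed
   coefficients vanish almost everywhere. *)
have [L T0] := transform_decomposition cb anova_kernel_bounded anchored_kernel_bounded
  (fun y t => erefl) (lexx 1%E) dc dec.
have Td := anchored_unique dc (d := transform c gamma d)
  (fun u (u0 : 0 < gamma u) => (Lfun1_integrable _ _).1 (L _ u0))
  (fun x cx => esym (T0 x cx)).
have md u : 0 < gamma u -> measurable_fun setT (d u).
  by move=> u0; apply/measurable_EFinP; case/integrableP : (di u u0).
move=> u; have [n] := ubnP (s - #|u|); elim: n u => // n IH u un u0.
(* There are finitely many proper supersets of u, so a single null set serves for all of them. *)
have : \forall t \ae cube_measure #|u|, forall v, (0 < gamma v) && (u \proper v) ->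
    partial_integral c (d v) t = 0.
  apply: filter_forall => v; case: andP => [[v0 uv]|nv]; last exact: nearW.
  have : \forall t \ae cube_measure #|u|, partial_integral c (d v) t = 0.
    apply: partial_integral_ae0 => //; first exact: md.
    apply: IH => //; have := proper_card uv; have := max_card v.
    rewrite card_ord; lia.
  by apply: filterS => t ->.
have := Td u u0; apply: filterS2 => t.
rewrite /transform (bigD1 u)/=; last by rewrite u0 subxx.
rewrite partial_integral_id => du dv.
move: du; rewrite big1 ?addr0// => v /andP[/andP[v0 uv] vu].
by apply: dv; rewrite v0 finset.properEneq eq_sym vu.
Qed.

Lemma decomposition_ae k p gamma f (h h' : coef_family) :
  (forall y, unit_bounded (k y)) -> (1 <= p)%E -> unique_components k gamma ->
  decomposition k p gamma f h -> decomposition k p gamma f h' ->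
  forall u, 0 < gamma u -> \forall t \ae cube_measure #|u|, h u t = h' u t.
Proof.
move=> kb p1 uk [Lh fh] [Lh' fh'] u u0.
have hi v (v0 : 0 < gamma v) := Lfun_prob_integrable p1 (Lh v v0).
have hi' v (v0 : 0 < gamma v) := Lfun_prob_integrable p1 (Lh' v v0).
have : \forall t \ae cube_measure #|u|, h u t - h' u t = 0.
  apply: (uk (fun v t => h v t - h' v t)) => //.
- move=> v v0; apply: (Lfun_prob_integrable p1).
  by apply: Lfun_sub => //; [exact: Lh|exact: Lh'].
- move=> x cx; under eq_bigr => v v0 do rewrite component_sub ?hi ?hi'//.
  by rewrite sumrB -fh// -fh'// subrr.
by apply: filterS => t /eqP; rewrite subr_eq0 => /eqP.
Qed.

(** The decomposition chosen in [space_norm] agrees almost everywhere with any other one, so the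
    norm may be computed from whichever is at hand. *)
Lemma space_normE k p gamma f (h : coef_family) :
  (forall y, unit_bounded (k y)) -> (1 <= p)%E -> unique_components k gamma ->
  decomposition k p gamma f h -> space_norm k p gamma f = family_norm p gamma h.
Proof.
move=> kb p1 uk hf; rewrite /space_norm; case: pselect => [e|[]]; last by exists h.
case: cid => h' /= hf' {e}.
have E u : 0 < gamma u ->
    ('N[cube_measure #|u|]_p[EFin \o h' u] = 'N[cube_measure #|u|]_p[EFin \o h u])%E.
  move=> u0; apply: ae_eq_Lnorm => //.
  - exact: Lfun_measurable (hf'.1 u u0).
  - exact: Lfun_measurable (hf.1 u u0).
  - exact: (decomposition_ae kb p1 uk hf' hf u0).
rewrite /family_norm; case: p p1 uk hf hf' E => [r||//] p1 uk hf hf' E.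
- by congr (_ `^ _)%E; apply: eq_bigr => u u0; rewrite E.
- by apply: eq_bigr => u u0; rewrite E.
Qed.

End decompositions.

(** * Finite diameter weights *)

Section finite_diameter.
Variables (s q : nat).
Implicit Types u v : {set 'I_s}.

Lemma diam_leP u : reflect (forall i j : 'I_s, i \in u -> j \in u -> (i <= j + q)%N)
  (diam u <= q)%N.
Proof.
apply: (iffP idP) => [uq i j iu ju|uq].
  have /bigmax_leqP/(_ i iu)/bigmax_leqP/(_ j ju) := uq; lia.
apply/bigmax_leqP => i iu; apply/bigmax_leqP => j ju.
have := uq i j iu ju; have := uq j i ju iu; lia.
Qed.

Lemma diam_subset u v : v \subset u -> (diam u <= q)%N -> (diam v <= q)%N.
Proof.
move=> /fintype.subsetP vu /diam_leP uq; apply/diam_leP => i j iv jv.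
by apply: uq; exact: vu.
Qed.

Definition window (i : 'I_s) : {set 'I_s} := [set j : 'I_s | (i <= j <= i + q)%N].

Lemma card_window i : (#|window i| <= q.+1)%N.
Proof.
have inj : {in window i &, injective (fun j : 'I_s => inord (j - i) : 'I_q.+1)}.
  move=> j k; rewrite !inE => /andP[ij jq] /andP[ik kq] /(congr1 val) /=.
  rewrite !inordK; [|lia|lia] => jk; apply: val_inj => /=; lia.
by rewrite -(card_in_imset inj) -[leqRHS]card_ord max_card.
Qed.

(** Start the window at the least element of u; the empty set fits into any window, and one exists
    as s > 0. *)
Lemma diam_window u : (0 < s)%N -> (diam u <= q)%N -> exists i, u \subset window i.
Proof.
move=> s0 /diam_leP uq; have [->|[i0 i0u]] := set_0Vmem u.
  by exists (Ordinal s0); exact: finset.sub0set.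
case: (arg_minnP (fun i : 'I_s => i : nat) i0u) => i iu imin.
exists i; apply/fintype.subsetP => j ju; rewrite inE imin//=.
exact: uq.
Qed.

Lemma card_diam_le u : (0 < s)%N -> (diam u <= q)%N -> (#|u| <= q.+1)%N.
Proof.
move=> s0 /(diam_window s0)[i /subset_leq_card ui].
exact: leq_trans (card_window i).
Qed.

(** There are s windows, each with at most 2^(q+1) subsets, and together these subsets include all
    sets in question. *)
Lemma count_diam_le : (0 < s)%N -> (#|[pred u : {set 'I_s} | diam u <= q]| <= s * 2
  ^ q.+1)%N.
Proof.
move=> s0.
apply: (@leq_trans #|(\bigcup_(i : 'I_s) powerset (window i))%SET|).
  apply: subset_leq_card; apply/fintype.subsetP => u;
    rewrite !inE => /(diam_window s0)[i ui].
  by apply/finset.bigcupP; exists i; rewrite // inE.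
apply: (@leq_trans (\sum_(i < s) #|powerset (window i)|)%N).
  elim/big_ind2: _ => [|A m B n Am Bn|//]; first by rewrite cards0.
  by apply: leq_trans (leq_card_setU _ _) _; exact: leq_add.
apply: (@leq_trans (\sum_(i < s) 2 ^ q.+1)%N); last by rewrite sum_nat_const card_ord.
by apply: leq_sum => i _; rewrite card_powerset leq_exp2l// card_window.
Qed.

End finite_diameter.

(** Hoelder's inequality up to the factor 2^r: [x <= l + l * (x / l)^r] for
    [x >= 0], and the chosen [l] balances the sums of the two terms. *)
Lemma powR_sum_le (R : realType) (I : finType) (A : pred I) (a : I -> R) (r N : R) :
  1 <= r -> 0 < N -> (#|A|%:R <= N) -> (forall i, A i -> 0 <= a i) ->
  (\sum_(i | A i) a i) `^ r <= 2 `^ r * N `^ (r - 1) * \sum_(i | A i) a i `^ r.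
Proof.
move=> r1 N0 AN a0; set S := \sum_(i | A i) a i `^ r.
have r0 : 0 < r by apply: lt_le_trans r1.
have S0 : 0 <= S by apply: sumr_ge0 => i _; exact: powR_ge0.
(* The case S = 0 is split off because the threshold l below has to be positive. *)
have [S00|SN0] := eqVneq S 0.
  rewrite S00 mulr0 big1 ?powR0 ?gt_eqF// => i Ai.
  have /eqP := S00; rewrite psumr_eq0; last by move=> j _; exact: powR_ge0.
  by move=> /allP/(_ i (mem_index_enum i)); rewrite Ai /= => /eqP/powR_eq0_eq0.
have {SN0 S0} S0 : 0 < S by rewrite lt0r SN0.
pose l := (S / N) `^ r^-1.
have l0 : 0 < l by rewrite powR_gt0// divr_gt0.
have lr : l `^ r = S / N by rewrite -powRrM mulVf ?gt_eqF// powRr1// divr_ge0 ?ltW.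
have lV : l^-1 `^ r = (l `^ r)^-1.
  by rewrite -powR_inv1 ?(ltW l0)// -powRrM mulN1r powRN.
(* If a_i > l, then a_i / l exceeds 1 and is at most its r-th power. *)
have le i : A i -> a i <= l + l * (a i `^ r / (l `^ r)).
  move=> Ai; have [ail|lai] := leP (a i) l.
    by rewrite (le_trans ail)// lerDl mulr_ge0 ?divr_ge0 ?powR_ge0 ?(ltW l0).
  have : a i / l <= (a i / l) `^ r by rewrite le1r_powR// ler_pdivlMr// mul1r ltW.
  rewrite powRM ?a0 ?invr_ge0 ?(ltW l0)// lV ler_pdivrMr// mulrC => /le_trans; apply.
  by rewrite lerDr ltW.
have : \sum_(i | A i) a i <= 2 * l * N.
  apply: le_trans (ler_sum _ le) _.
  rewrite big_split/= sumr_const -mulr_sumr -mulr_suml -/S lr.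
  rewrite invf_div [S * _]mulrC divfK ?gt_eqF//.
  rewrite -[l *+ _]mulr_natr; have : l * #|A|%:R <= l * N by rewrite ler_pM2l.
  lra.
move=> sl; apply: (@le_trans _ _ ((2 * l * N) `^ r)).
  by apply: ge0_ler_powR => //; rewrite ?nnegrE ?(ltW r0) ?sumr_ge0// !mulr_ge0// ltW.
rewrite !powRM ?mulr_ge0 ?(ltW l0) ?(ltW N0)// lr.
rewrite -(mulr_powRB1 (ltW N0) r0).
rewrite le_eqVlt; apply/orP; left; apply/eqP.
by field; rewrite gt_eqF.
Qed.

(** * Norms of constants and of finite sums *)

Section Lnorm_more.
Context d (T : measurableType d) (R : realType) (P : probability T R).

Lemma Lnorm_cst p (a : R) : (1 <= p)%E -> ('N[P]_p[EFin \o cst a] = `|a|%:E)%E.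
Proof.
case: p => [r||//] p1; rewrite unlock /Lnorm.
- rewrite lee_fin in p1; have r0 : 0 < r by apply: lt_le_trans p1.
  rewrite (eq_integral (cst (`|a| `^ r)%:E))// integral_cst//.
  rewrite [X in (_ * X)%E]probability_setT mule1 poweR_EFin -powRrM.
  by rewrite divff ?gt_eqF// powRr1.
- rewrite [X in (0%R < X)%E]probability_setT lte01; apply: ess_sup_ae_cst;
    last exact: nearW.
  by rewrite [X in (0%R < X)%E]probability_setT lte01.
Qed.

Lemma Lnorm_sum_le p I (r : seq I) (A : pred I) (F : I -> T -> R) : (1 <= p)%E ->
  (forall i, A i -> measurable_fun setT (F i)) ->
  measurable_fun setT (fun x => \sum_(i <- r | A i) F i x) /\
  ('N[P]_p[EFin \o (fun x => (\sum_(i <- r | A i) F i x)%R)]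
     <= \sum_(i <- r | A i) 'N[P]_p[EFin \o F i])%E.
Proof.
move=> p1 mF; elim: r => [|i r [mS IH]].
  rewrite big_nil; under eq_fun do rewrite big_nil.
  split; first exact: measurable_cst.
  by rewrite [X in (X <= _)%E](Lnorm_cst 0 p1) normr0.
under eq_fun do rewrite big_cons.
rewrite big_cons; case: ifPn => // Ai.
split; first by apply: measurable_funD => //; exact: mF.
apply: le_trans (eminkowski P (mF i Ai) mS p1) _.
by rewrite leeD2l.
Qed.

Lemma ae_Rintegral_ge0 (f : T -> R) : measurable_fun setT f ->
  (\forall x \ae P, 0 <= f x) -> 0 <= \int[P]_x f x.
Proof.
move=> mf f0; rewrite (_ : \int[P]_x f x = \int[P]_x `|f x|).
  by apply: Rintegral_ge0.
rewrite /Rintegral; congr fine; apply: ae_eq_integral => //.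
- exact/measurable_EFinP.
- by apply/measurable_EFinP; exact: measurableT_comp.
- by apply: filterS f0 => x fx _; rewrite ger0_norm.
Qed.

End Lnorm_more.

(** * Weighted norms of coefficient families *)

Section family_norm_lemmas.
Context {R : realType} {s : nat}.
Variables (gamma : {set 'I_s} -> R).
Implicit Types (u : {set 'I_s}).

Lemma Lfun_Lnorm_fine (h : @coef_family R s) p u : h u \in Lfun (cube_measure #|u|) p ->
  ('N[cube_measure #|u|]_p[EFin \o h u]
    = (fine 'N[cube_measure #|u|]_p[EFin \o h u])%:E)%E.
Proof.
by move=> /Lfun_inP[_ N]; rewrite fineK// ge0_fin_numE// Lnorm_ge0.
Qed.

Lemma family_norm_fin (h : @coef_family R s) (r : R) (n : {set 'I_s} -> R) : 0 < r ->
  (forall u, 0 < gamma u -> 0 <= n u /\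
    ('N[cube_measure #|u|]_(r%:E)[EFin \o h u] = (n u)%:E)%E) ->
  family_norm r%:E gamma h =
  ((\sum_(u : {set 'I_s} | 0 < gamma u) ((gamma u)^-1 * n u) `^ r) `^ r^-1)%:E.
Proof.
move=> r0 nE; rewrite /family_norm -poweR_EFin -sumEFin.
congr (_ `^ _)%E; apply: eq_bigr => u u0; have [n0 ->] := nE u u0.
rewrite poweR_EFin -EFinM powRM ?invr_ge0 ?(ltW u0)//.
by rewrite -[in RHS]powR_inv1 ?(ltW u0)// -powRrM mulN1r.
Qed.

Lemma family_norm_infty (h : @coef_family R s) (n : {set 'I_s} -> R) :
  (forall u, 0 < gamma u ->
    ('N[cube_measure #|u|]_(+oo)[EFin \o h u] = (n u)%:E)%E) ->
  family_norm +oo%E gamma h =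
  (\big[maxe/0]_(u : {set 'I_s} | (0 < gamma u)%R) ((gamma u)^-1 * n u)%:E)%E.
Proof. by move=> nE; apply: eq_bigr => u u0; rewrite nE. Qed.

(** Keep a single summand. This serves for the empty set, whose coefficient is the mean of the
    function. *)
Lemma le_family_norm (h : @coef_family R s) p u : (1 <= p)%E -> gamma u = 1 ->
  ('N[cube_measure #|u|]_p[EFin \o h u] <= family_norm p gamma h)%E.
Proof.
case: p => [r||//] p1 u1.
- rewrite lee_fin in p1; have r0 : 0 < r by apply: lt_le_trans p1.
  rewrite /= [X in (X <= _)%E](_ : _ = ('N[cube_measure #|u|]_r%:E[EFin \o h u] `^
    r) `^ r^-1)%E; last first.
    by rewrite -poweRrM divff ?gt_eqF// poweRe1 ?Lnorm_ge0.
  have T0 v : (0 <= (gamma v `^ (- r))%R%:E * ('N[cube_measure #|v|]_(r%:E)[EFin \o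
    h v]) `^ r)%E.
    by rewrite mule_ge0 ?poweR_ge0// lee_fin powR_ge0.
  apply: gt0_ler_poweR; rewrite ?invr_ge0 ?(ltW r0)//.
  + by rewrite in_itv/= poweR_ge0 leey.
  + by rewrite in_itv/= leey andbT sume_ge0.
  rewrite (bigD1 u)/= ?u1 ?ltr01// powR1 mul1e.
  by rewrite leeDl// sume_ge0.
- rewrite /= (bigD1 u) ?u1 ?ltr01//= invr1 mul1e.
  by rewrite le_max lexx.
Qed.

End family_norm_lemmas.

(** * Bounding the transformed coefficients under general weights *)

Section transform_bound.
Context {R : realType} {s : nat}.
Variables (gamma : {set 'I_s} -> R) (c : R -> R) (W W' N : R) (K : nat).
Hypothesis cb : unit_bounded c.
Hypothesis dc : down_closed gamma.
Hypothesis gW : forall u, 0 < gamma u -> gamma u <= W.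
Hypothesis gW' : forall u, 0 < gamma u -> (gamma u)^-1 <= W'.
Hypothesis gN : #|[pred u | 0 < gamma u]|%:R <= N.
Hypothesis gK : forall u, 0 < gamma u -> (2 ^ #|u| <= K)%N.
Hypotheses (W0 : 0 < W) (W'0 : 0 < W') (N0 : 0 < N).

Let cnorm (h : coef_family) p (u : {set 'I_s}) : R :=
  fine 'N[cube_measure #|u|]_p[EFin \o (h u : vec R #|u| -> R)]%E.

(** Minkowski and the contraction property of partial integrals give the unweighted inequality; [W']
    absorbs the weight of v, and 1 <= W / gamma_u inserts the weights of the u. *)
Lemma transform_norm_le p (h : coef_family) : (1 <= p)%E ->
  (forall u, 0 < gamma u -> h u \in Lfun (cube_measure #|u|) p) ->
  forall v, 0 < gamma v ->
  (gamma v)^-1 * cnorm (transform c gamma h) p v <=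
    W * W' * \sum_(u : {set 'I_s} | (0 < gamma u) && (v \subset u)) (gamma u)^-1 *
      cnorm h p u.
Proof.
move=> p1 Lh v v0.
have Lt : (transform c gamma h) v \in Lfun (cube_measure #|v|) p.
  exact: Lfun_transform.
have n0 (g : coef_family) u : 0 <= cnorm g p u by rewrite fine_ge0// Lnorm_ge0.
have le1 : cnorm (transform c gamma h) p v <=
    \sum_(u : {set 'I_s} | (0 < gamma u) && (v \subset u)) cnorm h p u.
  rewrite -lee_fin -Lfun_Lnorm_fine// -sumEFin.
  have mF u : (0 < gamma u) && (v \subset u) ->
      measurable_fun setT (partial_integral c (h u) : vec R #|v| -> R).
    by move=> /andP[u0 _]; apply: measurable_partial_integral => //;
      exact: Lfun_measurable (Lh u u0).
  apply: le_trans (Lnorm_sum_le _ _ p1 mF).2 _.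
  apply: lee_sum => u /andP[u0 _]; rewrite -Lfun_Lnorm_fine//; last exact: Lh.
  by apply: Lnorm_partial_integral => //; exact: Lfun_measurable (Lh u u0).
apply: (@le_trans _ _ (W' * \sum_(u : {set 'I_s} | (0 < gamma u) && (v \subset u))
  cnorm h p u)).
  by apply: ler_pM => //; rewrite ?invr_ge0 ?(ltW v0) ?gW'.
rewrite [W * W']mulrC -mulrA ler_pM2l// mulr_sumr; apply: ler_sum => u /andP[u0 _].
rewrite mulrA -[X in X <= _]mul1r ler_wpM2r// -(divff (lt0r_neq0 u0)).
by rewrite ler_wpM2r ?gW// invr_ge0 ltW.
Qed.

(** In r-th powers, comparing sums of at most [N] terms costs 2^r N^(r-1), and every u is counted at
    most [K] times. The r-th root turns this into 2 N^(1 - 1/r) K^(1/r), and K^(1/r) <= K. *)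
Lemma transform_bound_fin (r : R) (h : coef_family) : 1 <= r ->
  (forall u, 0 < gamma u -> h u \in Lfun (cube_measure #|u|) r%:E) ->
  (family_norm r%:E gamma h <= 1)%E ->
  (family_norm r%:E gamma (transform c gamma h)
    <= (W * W' * 2 * N `^ (1 - r^-1) * K%:R)%:E)%E.
Proof.
move=> r1 Lh; have r0 : 0 < r by apply: lt_le_trans r1.
have p1 : (1 <= r%:E)%E by rewrite lee_fin.
have Lt v : 0 < gamma v -> (transform c gamma h) v \in Lfun (cube_measure #|v|) r%:E.
  by move=> _; exact: Lfun_transform.
have n0 (g : coef_family) u : 0 <= cnorm g r%:E u by rewrite fine_ge0// Lnorm_ge0.
rewrite (family_norm_fin (n := cnorm h r%:E))//; last first.
  by move=> u u0; split=> //; apply: Lfun_Lnorm_fine; exact: Lh.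
rewrite (family_norm_fin (n := cnorm (transform c gamma h) r%:E))//; last first.
  by move=> u u0; split=> //; apply: Lfun_Lnorm_fine; exact: Lt.
rewrite !lee_fin => h1.
pose a u := (gamma u)^-1 * cnorm h r%:E u.
have a0 u : 0 < gamma u -> 0 <= a u by move=> u0; rewrite mulr_ge0// invr_ge0 ltW.
have S1 : \sum_(u : {set 'I_s} | 0 < gamma u) a u `^ r <= 1.
  have S0 : 0 <= \sum_(u : {set 'I_s} | 0 < gamma u) a u `^ r.
    by apply: sumr_ge0 => u _; exact: powR_ge0.
  have := ge0_ler_powR (ltW r0) (powR_ge0 _ _ : _ \in Num.nneg) (ler01 : 1 \in
    Num.nneg) h1.
  by rewrite -powRrM mulVf ?gt_eqF// powRr1// powR1.
pose B := (W * W' * 2) `^ r * N `^ (r - 1) * K%:R.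
have WW0 : 0 < W * W' * 2 by rewrite !mulr_gt0.
have : \sum_(v : {set 'I_s} | 0 < gamma v)
    ((gamma v)^-1 * cnorm (transform c gamma h) r%:E v) `^ r <= B.
  apply: (@le_trans _ _ (\sum_(v : {set 'I_s} | 0 < gamma v) (W * W') `^ r *
     (2 `^ r * N `^ (r - 1) * \sum_(u : {set 'I_s} | (0 < gamma u) && (v \subset u))
       a u `^ r))).
    apply: ler_sum => v v0.
    have S0 : 0 <= \sum_(u : {set 'I_s} | (0 < gamma u) && (v \subset u)) a u.
      by apply: sumr_ge0 => u /andP[u0 _]; exact: a0.
    apply: (@le_trans _ _ ((W * W' * \sum_(u : {set 'I_s} | (0 < gamma u) && (v
      \subset u)) a u) `^ r)).
      apply: ge0_ler_powR; rewrite ?(ltW r0)//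
        ?nnegrE ?mulr_ge0 ?invr_ge0 ?(ltW v0) ?(ltW W0) ?(ltW W'0)//.
      exact: transform_norm_le.
    rewrite powRM ?mulr_ge0 ?(ltW W0) ?(ltW W'0)// ler_wpM2l ?powR_ge0//.
    apply: powR_sum_le => // [|u /andP[u0 _]]; last exact: a0.
    apply: le_trans gN; rewrite ler_nat; apply: subset_leq_card.
    by apply/fintype.subsetP => u; rewrite !inE => /andP[].
  rewrite -mulr_sumr -mulr_sumr mulrA mulrA -powRM ?mulr_ge0 ?(ltW W0) ?(ltW W'0)//.
  rewrite ler_wpM2l ?mulr_ge0 ?powR_ge0//.
  (* After the exchange each u occurs once for every subset v of positive weight, hence at most
     2^|u| <= K times. *)
  rewrite (exchange_big_dep (fun u => 0 < gamma u))/=; last by move=> v u _ /andP[].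
  apply: (@le_trans _ _ (\sum_(u : {set 'I_s} | 0 < gamma u) a u `^ r * K%:R)).
    apply: ler_sum => u u0;
      rewrite sumr_const -[X in X <= _]mulr_natr ler_wpM2l ?powR_ge0// ler_nat.
    apply: leq_trans (gK u0); rewrite -card_powerset; apply: subset_leq_card.
    by apply/fintype.subsetP => v; rewrite !inE => /and3P[].
  by rewrite -mulr_suml ler_piMl.
move=> TB; apply: (@le_trans _ _ (B `^ r^-1)).
  apply: ge0_ler_powR TB; rewrite ?invr_ge0 ?(ltW r0)// nnegrE.
    by apply: sumr_ge0 => u _; exact: powR_ge0.
  by rewrite !mulr_ge0 ?powR_ge0.
rewrite /B powRM ?mulr_ge0 ?powR_ge0// powRM ?powR_ge0// -!powRrM divff ?gt_eqF//.
rewrite powRr1 ?(ltW WW0)// mulrBl divff ?gt_eqF// mul1r.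
rewrite ler_wpM2l ?mulr_ge0 ?powR_ge0 ?(ltW W0) ?(ltW W'0)//.
(* K^(1/r) <= K uses K >= 1; for K = 0 both sides are 0. *)
have [->|K0] := eqVneq K 0%N; first by rewrite powR0// invr_eq0 gt_eqF.
by rewrite ler1_powR// ?ler1n ?lt0n// invf_le1.
Qed.

Lemma transform_bound_infty (h : coef_family) :
  (forall u, 0 < gamma u -> h u \in Lfun (cube_measure #|u|) +oo%E) ->
  (family_norm +oo%E gamma h <= 1)%E ->
  (family_norm +oo%E gamma (transform c gamma h) <= (W * W' * N)%:E)%E.
Proof.
move=> Lh; have p1 : (1 <= +oo :> \bar R)%E by rewrite leey.
have Lt v : 0 < gamma v -> (transform c gamma h) v \in Lfun (cube_measure #|v|) +oo%E.
  by move=> _; exact: Lfun_transform.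
rewrite (family_norm_infty (n := cnorm h +oo%E)); last first.
  by move=> u u0; apply: Lfun_Lnorm_fine; exact: Lh.
rewrite (family_norm_infty (n := cnorm (transform c gamma h) +oo%E)); last first.
  by move=> u u0; apply: Lfun_Lnorm_fine; exact: Lt.
move=> h1.
have a1 u : 0 < gamma u -> (gamma u)^-1 * cnorm h +oo%E u <= 1.
  by move=> u0; rewrite -lee_fin; apply: le_trans h1; rewrite (bigD1 u)//= le_max lexx.
have WWN : 0 <= W * W' * N by rewrite !mulr_ge0// ltW.
elim/big_ind: _ => [|x y xN yN|v v0]; first by rewrite lee_fin.
  by rewrite ge_max xN yN.
rewrite lee_fin; apply: le_trans (transform_norm_le p1 Lh v0) _.
rewrite ler_wpM2l// ?mulr_ge0 ?(ltW W0) ?(ltW W'0)//.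
apply: (@le_trans _ _ (\sum_(u : {set 'I_s} | (0 < gamma u) && (v \subset u)) 1)).
  by apply: ler_sum => u /andP[u0 _]; exact: a1.
rewrite sumr_const; apply: le_trans gN; rewrite ler_nat; apply: subset_leq_card.
by apply/fintype.subsetP => u; rewrite !inE => /andP[].
Qed.

End transform_bound.

(** * The two bounds on the embedding for finite diameter weights *)

Section finite_diameter_weights.
Context {R : realType} (omega : R) (q s : nat).
Hypotheses (omega0 : 0 < omega) (s0 : (0 < s)%N).
Implicit Types u v : {set 'I_s}.

Local Notation gamma := (@finite_diameter_weight R omega q s).

Lemma finite_diameter_weight_gt0 u : (0 < gamma u) = (diam u <= q)%N.
Proof. by rewrite /finite_diameter_weight; case: ifP => _;
  rewrite ?exprn_gt0 ?ltxx. Qed.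

Lemma finite_diameter_weightE u : 0 < gamma u -> gamma u = omega ^+ #|u|.
Proof. by rewrite finite_diameter_weight_gt0 /finite_diameter_weight => ->. Qed.

Lemma finite_diameter_weight_down : down_closed gamma.
Proof. by move=> u v vu; rewrite !finite_diameter_weight_gt0; exact: diam_subset. Qed.

(** Replacing the base by its maximum with 1 makes powers increase with the exponent, so that omega
    < 1 and omega > 1 are treated alike. *)
Lemma expr_le_max1 (a : R) m n : 0 <= a -> (m <= n)%N -> a ^+ m <= Num.max 1 a ^+ n.
Proof.
move=> a0 mn; apply: (@le_trans _ _ (Num.max 1 a ^+ m)).
  by rewrite lerXn2r// ?nnegrE// ?le_max ?lexx ?ler01 ?orbT.
by rewrite ler_weXn2l// le_max lexx.
Qed.

Lemma finite_diameter_weight_le u : 0 < gamma u -> gamma u <= Num.max 1 omega ^+ q.+1.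
Proof.
move=> u0; rewrite finite_diameter_weightE// expr_le_max1 ?(ltW omega0)//.
by rewrite card_diam_le// -finite_diameter_weight_gt0.
Qed.

Lemma finite_diameter_weightV_le u : 0 < gamma u ->
  (gamma u)^-1 <= Num.max 1 omega^-1 ^+ q.+1.
Proof.
move=> u0; rewrite finite_diameter_weightE//
  -exprVn expr_le_max1 ?invr_ge0 ?(ltW omega0)//.
by rewrite card_diam_le// -finite_diameter_weight_gt0.
Qed.

Lemma anchored_kernelE (y t : R) : anchored_kernel y t = anova_kernel y t + (1 - t).
Proof. by rewrite /anova_kernel subrK. Qed.

Variable p : \bar R.
Hypothesis p1 : (1 <= p)%E.

Lemma embedding_norm_le :
  (embedding_norm p gamma <=
   (Num.max 1 omega ^+ q.+1 * Num.max 1 omega^-1 ^+ q.+1 * 2 *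
    (s * 2 ^ q.+1)%:R `^ (1 - fine p^-1) * (2 ^ q.+1)%:R)%:E)%E.
Proof.
apply: ge_ereal_sup => _ [f [[h hf] fn] <-].
have dc := finite_diameter_weight_down.
have hf' := transform_decomposition onem_bounded anchored_kernel_bounded
  anova_kernel_bounded anchored_kernelE p1 dc hf.
move: fn; rewrite /anchored_norm /anova_norm.
rewrite (space_normE anchored_kernel_bounded p1 (anchored_unique dc) hf).
rewrite (space_normE anova_kernel_bounded p1 (anova_unique dc) hf').
have N0 : 0 < (s * 2 ^ q.+1)%:R :> R by rewrite ltr0n muln_gt0 s0 expn_gt0.
have W0 a : 0 < Num.max 1 a ^+ q.+1 :> R by rewrite exprn_gt0// lt_max ltr01.
have cN : #|[pred u | 0 < gamma u]|%:R <= (s * 2 ^ q.+1)%:R :> R.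
  rewrite ler_nat (leq_trans _ (count_diam_le q s0))//.
  by rewrite leq_eqVlt (eq_card (B := [pred u : {set 'I_s} | diam u <= q]%N))
    ?eqxx// => u; rewrite !inE finite_diameter_weight_gt0.
have cK u : 0 < gamma u -> (2 ^ #|u| <= 2 ^ q.+1)%N.
  by rewrite finite_diameter_weight_gt0 => /(card_diam_le s0) uq; rewrite leq_exp2l.
case: p p1 hf => [r||//] r1 [Lh _] fn.
- rewrite lee_fin in r1; rewrite inver gt_eqF ?(lt_le_trans ltr01 r1)//=.
  by apply: transform_bound_fin fn => //;
    [exact: onem_bounded|exact: finite_diameter_weight_le|exact:
      finite_diameter_weightV_le].
(* For p infinite the bound comes without the factors 2 and 2^(q+1); both are at least 1 and are
   inserted to unify the statement. *)
- apply: (@le_trans _ _ (Num.max 1 omega ^+ q.+1 * Num.max 1 omega^-1 ^+ q.+1 * (s *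
    2 ^ q.+1)%:R)%:E).
    by apply: transform_bound_infty fn => //;
      [exact: onem_bounded|exact: finite_diameter_weight_le|exact:
        finite_diameter_weightV_le].
  rewrite lee_fin invey/= subr0 powRr1 ?(ltW N0)//.
  have K1 : 1 <= (2 ^ q.+1)%:R :> R by rewrite ler1n expn_gt0.
  rewrite -!mulrA !ler_pM2l ?W0// mulrCA ler_peMr ?(ltW N0)//; lra.
Qed.

Lemma integrable_onem (i : 'I_s) :
  (@cube_measure R s).-integrable setT (EFin \o (fun y => 1 - tnth y i)).
Proof.
have i1 : (@cube_measure R s).-integrable setT (EFin \o (fun=> 1)).
  exact: finite_measure_integrable_cst.
have := integrable_prod_coord (fun=> onem_bounded) [set i]%SET i1.
congr (_.-integrable _ (_ \o _)); apply/funext => t.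
by rewrite mul1r big_set1.
Qed.

(** On the cube, 1 - y_i is at least 1/2 times the indicator of y_i <= 1/2, an event of measure 1/2.
    The exact mean 1/2 would only improve the constant. *)
Lemma onem_integral_ge (i : 'I_s) : 4^-1 <= \int[@cube_measure R s]_y (1 - tnth y i).
Proof.
pose B : set (vec R s) := box (fun j => if j == i then `[0, 2^-1]%classic else setT).
have mB : measurable B by apply: measurable_box => j; case: eqP.
have muB : cube_measure s B = (2^-1)%:E.
  rewrite cube_measure_box => [|j]; last by case: eqP.
  rewrite (bigD1 i)//= eqxx big1 => [|j /negbTE ->]; last first.
    by rewrite [X in fine X]probability_setT.
  rewrite mulr1 /unit_measure /mrestr setIidl; last first.
    move=> x /=; rewrite !in_itv/= => /andP[-> x2].
    by apply: le_trans x2 _; rewrite invf_le1// ler1n.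
  rewrite lebesgue_measure_itv/= lte_fin invr_gt0 ltr0n/=.
  by rewrite subr0.
have i1 : (@cube_measure R s).-integrable setT (EFin \o (fun=> 1)).
  exact: finite_measure_integrable_cst.
have m1B : measurable_fun setT (\1_B : vec R s -> R) by exact: measurable_indic.
have i1B : (@cube_measure R s).-integrable setT (EFin \o (fun y => \1_B y)).
  have := ae_le1_integrable (w := \1_B) i1 m1B (nearW _ _).
  under [in X in X -> _]eq_fun do rewrite mul1r; apply=> y.
  by rewrite indicE; case: (_ \in _); rewrite ?normr1 ?normr0.
have iB : (@cube_measure R s).-integrable setT (EFin \o (fun y => 2^-1 * \1_B y)).
  exact: (integrableZl measurableT 2^-1 i1B).
have iy := integrable_onem i.
have : 0 <= \int[@cube_measure R s]_y ((1 - tnth y i) - 2^-1 * \1_B y).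
  apply: ae_Rintegral_ge0.
    apply: measurable_funB; last by apply: measurable_funM => //; exact: measurable_cst.
    exact: (measurableT_comp measurable_onem (measurable_vec_tnth i)).
  apply: filterS (ae_cube s) => y cy; have /andP[y0 y1] := cy i.
  rewrite indicE; case: (boolP (y \in B)) => [|_]; last by rewrite mulr0 subr0 subr_ge0.
  rewrite inE => /(_ i); rewrite eqxx /= in_itv/= => /andP[_ y2]; lra.
rewrite RintegralB// subr_ge0 => h; apply: le_trans h.
rewrite RintegralZl// /Rintegral integral_indic// setIT [X in fine X]muB /=; lra.
Qed.

(** Anchored coefficients of the function a (x_1 + ... + x_s) on the cube. *)
Definition test_family (a : R) : @coef_family R s :=
  fun u _ => if #|u| == 1%N then a else 0.
Arguments test_family : clear implicits.

Lemma finite_diameter_weight_singleton u : #|u| = 1%N -> gamma u = omega.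
Proof.
move=> u1; rewrite finite_diameter_weightE ?u1 ?expr1// finite_diameter_weight_gt0.
have /cards1P[i ->] : #|u| == 1%N by rewrite u1.
by apply/diam_leP => j k; rewrite !inE => /eqP -> /eqP ->; exact: leq_addr.
Qed.

Lemma finite_diameter_weight_set0 : gamma finset.set0 = 1.
Proof.
rewrite finite_diameter_weightE ?cards0 ?expr0// finite_diameter_weight_gt0.
by apply/diam_leP => j k; rewrite inE.
Qed.

Lemma card_singletons : #|[set u : {set 'I_s} | #|u| == 1%N]%SET| = s.
Proof. by rewrite card_draws card_ord bin1. Qed.

Lemma test_family_Lnorm a u : 0 <= a ->
  ('N[cube_measure #|u|]_p[EFin \o (test_family a u : vec R #|u| -> R)] =
   (if #|u| == 1%N then a else 0)%:E)%E.
Proof.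
move=> a0; rewrite [X in EFin \o X](_ : _ = cst (if #|u| == 1%N then a else 0))//.
by rewrite Lnorm_cst// ger0_norm//; case: ifP.
Qed.

(** Each of the s singletons has weight omega, so for finite p it contributes (a / omega)^p = 1/s;
    for p infinite each weighted norm is 1. *)
Lemma test_family_norm_le :
  (family_norm p gamma (test_family (omega * s%:R `^ (- fine p^-1))) <= 1)%E.
Proof.
set a := omega * _.
have a0 : 0 <= a by rewrite mulr_ge0 ?powR_ge0// ltW.
have nE u := test_family_Lnorm u a0.
have s0R : 0 < s%:R :> R by rewrite ltr0n.
move: p1 @a a0 nE; case: p => [r||//] r1 a a0 nE.
- rewrite lee_fin in r1; have r0 : 0 < r by apply: lt_le_trans r1.
  rewrite (family_norm_fin (n := fun u => if #|u| == 1%N then a else 0))//; last first.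
    by move=> u _; split; [case: ifP|exact: nE].
  rewrite lee_fin; have -> : 1 = 1 `^ r^-1 :> R by rewrite powR1.
  apply: ge0_ler_powR; rewrite ?invr_ge0 ?(ltW r0)// ?nnegrE ?ler01//.
    by apply: sumr_ge0 => u _; exact: powR_ge0.
  apply: (@le_trans _ _ (\sum_(u in [set u : {set 'I_s} | #|u| == 1%N]%SET)
    s%:R^-1)); last first.
    by rewrite sumr_const card_singletons -[X in X <= _]mulr_natr mulVf// gt_eqF.
  rewrite [X in X <= _]big_mkcond [X in _ <= X]big_mkcond; apply: ler_sum => u _.
  rewrite inE; case: ifPn => [u0|_]; last by case: ifP => // _; rewrite invr_ge0.
  case: eqP => [u1|_]; last by rewrite mulr0 powR0// gt_eqF.
  rewrite finite_diameter_weight_singleton// /a mulrA mulVf ?gt_eqF// mul1r.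
  rewrite -powRrM inver gt_eqF//= mulNr mulVf ?gt_eqF// powR_inv1//.
- rewrite (family_norm_infty (n := fun u => if #|u| == 1%N then a else 0));
    last by move=> u _; exact: nE.
  elim/big_ind: _ => [|x y xN yN|u u0]; first by rewrite lee_fin.
    by rewrite ge_max xN yN.
  rewrite lee_fin; case: eqP => [u1|_]; last by rewrite mulr0.
  rewrite finite_diameter_weight_singleton// /a invey oppr0 powRr0 mulr1.
  by rewrite mulVf// gt_eqF.
Qed.

Lemma embedding_norm_ge :
  ((omega / 4 * s%:R `^ (1 - fine p^-1))%:E <= embedding_norm p gamma)%E.
Proof.
set eta := fine p^-1; pose a := omega * s%:R `^ (- eta).
have s0R : 0 < s%:R :> R by rewrite ltr0n.
have a0 : 0 <= a by rewrite mulr_ge0 ?powR_ge0// ltW.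
pose f (x : vec R s) := \sum_(u : {set 'I_s} | 0 < gamma u)
  component anchored_kernel (test_family a u : vec R #|u| -> R) x.
have dc := finite_diameter_weight_down.
have hf : decomposition anchored_kernel p gamma f (test_family a).
  split=> // u _; apply/Lfun_inP; split; first exact: measurable_cst.
  by rewrite test_family_Lnorm// ltry.
have hf' := transform_decomposition onem_bounded anchored_kernel_bounded
  anova_kernel_bounded anchored_kernelE p1 dc hf.
apply: (@le_trans _ _ (anova_norm p gamma f)); last first.
  apply: ereal_sup_ubound; exists f => //; split; first by exists (test_family a).
  rewrite /anchored_norm (space_normE anchored_kernel_bounded p1 (anchored_unique
    dc) hf).
  exact: test_family_norm_le.
rewrite /anova_norm (space_normE anova_kernel_bounded p1 (anova_unique dc) hf').
(* The empty set has weight 1, so its ANOVA coefficient, the mean of f, bounds the norm from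
   below. *)
apply: le_trans (le_family_norm _ p1 finite_diameter_weight_set0).
pose b := a / 4 * s%:R.
have b0 : 0 <= b by apply: mulr_ge0 => //; apply: divr_ge0.
have -> : omega / 4 * s%:R `^ (1 - eta) = b.
  rewrite /b /a powRD ?powRr1 ?(ltW s0R)//; last by rewrite (gt_eqF s0R) implybT.
  by field.
rewrite -{1}(ger0_norm b0) -(Lnorm_cst (cube_measure #|finset.set0 : {set 'I_s}|) b p1).
apply: ae_le_Lnorm => //.
  apply: Lfun_measurable (hf'.1 finset.set0 _).
  by rewrite finite_diameter_weight_set0.
apply: nearW => z /=; rewrite (ger0_norm b0); apply: le_trans (ler_norm _).
(* Every set contains the empty set, but only the s singletons have a nonzero coefficient; each
   contributes at least a / 4. *)
rewrite /transform (bigID (fun u : {set 'I_s} => #|u| == 1%N))/= [X in _ + X]big1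
  ?addr0; last first.
  move=> u /andP[_ u1]; rewrite /partial_integral.
  under eq_Rintegral do rewrite /integrand /test_family (negbTE u1) mul0r.
  by rewrite Rintegral_cst// mul0r.
apply: (@le_trans _ _ (\sum_(u : {set 'I_s} | (0 < gamma u) && (finset.set0 \subset
  u) && (#|u| == 1%N)) a / 4)).
  rewrite sumr_const -[X in _ <= X]mulr_natr /b ler_wpM2l ?(divr_ge0 a0)// ler_nat.
  rewrite -{1}card_singletons; apply: subset_leq_card; apply/fintype.subsetP => u.
  rewrite inE => u1; rewrite unfold_in/= u1 finset.sub0set
    finite_diameter_weight_singleton ?omega0//; exact/eqP.
apply: ler_sum => u /andP[_ /cards1P[i ->{u}]].
rewrite /partial_integral.
under eq_Rintegral do rewrite /integrand /test_family cards1 eqxx finset.setD0 big_set1.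
rewrite RintegralZl//; last exact: integrable_onem.
by rewrite ler_wpM2l// onem_integral_ge.
Qed.

End finite_diameter_weights.

Theorem proposition7 (R : realType) (p pstar : \bar R) (omega : R) (q : nat)
    (hp : (1 <= p)%E) (hpstar : (p^-1 + pstar^-1 = 1)%E)
    (homega : 0 < omega) (hq : (1 <= q)%N) :
  exists c1 c2 : R, [/\ 0 < c1, c1 <= c2 &
    \forall s \near \oo,
      ((c1 * (s%:R - q%:R) `^ fine (pstar^-1)%E)%:E
         <= embedding_norm p (@finite_diameter_weight R omega q s)
         <= (c2 * (s%:R - q%:R) `^ fine (pstar^-1)%E)%:E)%E].
Proof.
(* [eta] is 1/p, with value 0 for p infinite, and [theta] below is 1/[pstar] = 1 - eta. *)
have [eta etaE eta01] : exists2 eta : R, (p^-1 = eta%:E)%E & 0 <= eta <= 1.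
  case: p hp {hpstar} => [r||//] r1; last by exists 0; rewrite ?invey ?lexx ?ler01.
  rewrite lee_fin in r1; have r0 : 0 < r by apply: lt_le_trans r1.
  exists r^-1; first by rewrite inver gt_eqF.
  by rewrite invr_ge0 (ltW r0) invf_le1.
have thetaE : fine pstar^-1 = 1 - fine p^-1.
  move: hpstar; rewrite etaE; case: (pstar^-1)%E => [t||]//= [<-].
  by rewrite addrAC subrr add0r.
rewrite etaE /= in thetaE.
set theta := fine pstar^-1 in thetaE *.
have t0 : 0 <= theta by move: eta01; rewrite thetaE; lra.
have t1 : theta <= 1 by move: eta01; rewrite thetaE; lra.
pose K : R := (2 ^ q.+1)%:R.
have K1 : 1 <= K by rewrite ler1n expn_gt0.
pose V := Num.max 1 omega ^+ q.+1 * Num.max 1 omega^-1 ^+ q.+1 * 2.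
have V0 : 0 < V.
  by rewrite !mulr_gt0// exprn_gt0// lt_max ltr01.
(* [V] and the last [K] come from the upper bound for the embedding; 2 * K pays for replacing s
   2^(q+1) by s - q. The maximum ensures c1 <= c2. *)
exists (omega / 4), (Num.max (omega / 4) (V * (2 * K) * K)); split.
- by rewrite divr_gt0.
- by rewrite le_max lexx.
(* For s > 2q one has s - q <= s <= 2 (s - q), so the powers of s and of s - q are comparable. *)
exists (2 * q).+1 => // s /= qs; have s0 : (0 < s)%N by apply: leq_trans qs.
have qsR : 2 * q%:R <= s%:R :> R by rewrite -natrM ler_nat ltnW.
have q0R : 0 <= q%:R :> R by [].
apply/andP; split.
  apply: le_trans _ (embedding_norm_ge q homega s0 hp); rewrite lee_fin etaE /= -thetaE.
  rewrite ler_wpM2l ?divr_ge0 ?(ltW homega)//.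
  by apply: ge0_ler_powR; rewrite // ?nnegrE; lra.
apply: le_trans (embedding_norm_le q homega s0 hp) _;
  rewrite lee_fin etaE /= -thetaE -/V.
apply: (@le_trans _ _ (V * (2 * K) * K * (s%:R - q%:R) `^ theta)); last first.
  by rewrite ler_wpM2r ?powR_ge0// le_max lexx orbT.
rewrite -/K -mulrA -[X in _ <= X]mulrA -mulrA ler_pM2l//.
rewrite [K * _]mulrC mulrA ler_wpM2r ?(le_trans ler01)//.
(* Since 2 K >= 1 and theta <= 1, the factor (2 K)^theta split off here is at most 2 K. *)
apply: (@le_trans _ _ ((2 * K * (s%:R - q%:R)) `^ theta)).
  apply: ge0_ler_powR; rewrite // ?nnegrE ?natrM ?mulr_ge0//; try lra.
  have : 0 <= K * (s%:R - 2 * q%:R) by rewrite mulr_ge0 ?subr_ge0// (le_trans ler01).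
  rewrite -/K; lra.
rewrite powRM; [|lra|lra]; rewrite ler_wpM2r ?powR_ge0// ler1_powR//; lra.
Qed.
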